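(* Let $p$ be an odd prime and let $G$ be a noncapable finite $2$-generator $p$-group of nilpotency class two. (1) If $G\cong K_1=\langle a,b\mid [a,b]^{p^{\gamma}}=[a,b,b]=[a,b,a]=b^{p^{\beta}}=1,\ a^{p^{\alpha}}=[a,b]^{p^{\rho}}\rangle$, where $\alpha>\beta\ge\gamma\ge1$ and $0\le\rho<\gamma$, then $\mathcal{M}^{(2)}(G)\cong\mathbb{Z}_{p^{\beta}}^{(2)}\oplus\mathbb{Z}_{p^{\rho}}^{(3)}$. (2) If $G\cong K_2=\langle a,b\mid a^{p^{\alpha}}=b^{p^{\beta}}=[a,b]^{p^{\gamma}}=[a,b,b]=[a,b,a]=1\rangle$, where $\alpha>\beta\ge\gamma\ge1$, then $\mathcal{M}^{(2)}(G)\cong\mathbb{Z}_{p^{\beta}}^{(2)}\oplus\mathbb{Z}_{p^{\gamma}}^{(3)}$. (3) If $G\cong K_3=\langle a,b\mid a^{p^{\alpha}}=[a,b]^{p^{\gamma}}=[a,b,b]=[a,b,a]=1,\ b^{p^{\beta}}=[a,b]^{p^{\sigma}}\rangle$, where $\alpha>\beta\ge\gamma\ge1$ and $0\le\sigma<\sigma+\alpha-\beta<\gamma$, then $\mathcal{M}^{(2)}(G)\cong\mathbb{Z}_{p^{\alpha}}\oplus\mathbb{Z}_{p^{\beta}}\oplus\mathbb{Z}_{p^{\sigma}}^{(3)}$. (4) If $G\cong K_4=\langle a,b\mid [a,b]^{p^{\gamma}}=[a,b,b]=[a,b,a]=1,\ a^{p^{\alpha}}=[a,b]^{p^{\rho}},\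 b^{p^{\beta}}=[a,b]^{p^{\sigma}}\rangle$, where $\alpha>\beta\ge\gamma\ge1$ and $0\le\sigma<\rho<\min(\gamma,\sigma+\alpha-\beta)$, then $\mathcal{M}^{(2)}(G)\cong\mathbb{Z}_{p^{\rho-\sigma+\beta}}\oplus\mathbb{Z}_{p^{\beta}}\oplus\mathbb{Z}_{p^{\sigma}}^{(3)}$. (5) If $G\cong K_5=\langle a,b\mid [a,b]^{p^{\gamma}}=[a,b,b]=[a,b,a]=b^{p^{\alpha}}=1,\ a^{p^{\alpha}}=[a,b]^{p^{\rho}}\rangle$, where $\alpha>\gamma>\rho\ge0$, then $\mathcal{M}^{(2)}(G)\cong\mathbb{Z}_{p^{\alpha}}^{(2)}\oplus\mathbb{Z}_{p^{\rho}}^{(3)}$.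
   Context: Commutators are left-normed: $[x,y,z]=[[x,y],z]$. A group $G$ is capable if $G\cong H/Z(H)$ for some group $H$; otherwise it is noncapable. For a group $G\cong F/R$ with $F$ free and $R$ normal in $F$, the $2$-nilpotent multiplier of $G$ is the abelian group $\mathcal{M}^{(2)}(G)=(R\cap\gamma_3(F))/[R,F,F]$, where $\gamma_3(F)=[F,F,F]$; it is independent (up to isomorphism) of the choice of the free presentation. $\mathbb{Z}_r$ is the cyclic group of order $r$ and $\mathbb{Z}_r^{(t)}$ is the direct sum of $t$ copies of $\mathbb{Z}_r$. *)

(* Defs.v *)
From HB Require Import structures.
From mathcomp Require Import all_boot monoid.
From mathcomp Require Import generic_quotient boolp.

Set Implicit Arguments.
Unset Strict Implicit.
Unset Printing Implicit Defensive.

Local Open Scope group_scope.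
Local Open Scope quotient_scope.

Definition isomorphic (G H : groupType) : Prop :=
  exists f : {multiplicative G -> H}, bijective f.

Section Multiplicative.
Variables (G H : groupType) (f : {multiplicative G -> H}).

Lemma multiplicative1 : f 1 = 1.
Proof. by apply: (mulgI (f 1)); rewrite -gmulfM !mulg1. Qed.
Lemma multiplicativeV x : f x^-1 = (f x)^-1.
Proof. by apply: (mulgI (f x)); rewrite -gmulfM !mulgV multiplicative1. Qed.

End Multiplicative.

(* MathComp's subgroups and quotients are confined to finite groups, whereas
   the groups H and F in the definitions of capability and of the 2-nilpotent
   multiplier may be infinite.  Subgroups are the library's groupClosed
   predicates, and normalClosed adds stability under conjugation. *)

HB.mixin Record isConjClosed (G : groupType) (S : {pred G}) := {
  gpred_conj : forall x y : G, x \in S -> x ^ y \in S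
}.

#[short(type="normalClosed")]
HB.structure Definition NormalClosed (G : groupType) :=
  {S of isConjClosed G S & GroupClosed G S}.

Section Subgroup.
Variables (G : groupType) (S : groupClosed G).

Definition subgroup : Type := {x : G | x \in S}.

HB.instance Definition _ := SubChoice.on subgroup.

Lemma subgroup_closed : group_closed (fun x => x \in S).
Proof. by split=> [|x y]; [apply: gpred1 | apply: gpredF]. Qed.

HB.instance Definition _ :=
  SubChoice_isSubGroup.Build G (fun x => x \in S) subgroup subgroup_closed.

End Subgroup.

Section Quotient.
Variables (G : groupType) (N : normalClosed G).

Definition coset_rel : rel G := fun x y => x / y \in N.

Lemma coset_rel_refl : reflexive coset_rel.
Proof. by move=> x; rewrite /coset_rel mulgV gpred1. Qed.

Lemma coset_rel_sym : symmetric coset_rel.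
Proof. by move=> x y; rewrite /coset_rel gpredFC. Qed.

Lemma coset_rel_trans : transitive coset_rel.
Proof.
move=> y x z xy yz; rewrite /coset_rel.
by rewrite -(mulgVK y x) -mulgA gpredM.
Qed.

Definition coset_equiv :=
  EquivRel coset_rel coset_rel_refl coset_rel_sym coset_rel_trans.

Definition quotient_group : Type := {eq_quot coset_equiv}.

HB.instance Definition _ : EqQuotient G coset_equiv quotient_group :=
  EqQuotient.on quotient_group.
HB.instance Definition _ := Choice.on quotient_group.

Lemma quotient_eqP (x y : G) :
  reflect (\pi_quotient_group x = \pi_quotient_group y) (x / y \in N).
Proof. exact: (@eqquotP _ coset_equiv quotient_group). Qed.

Definition qmul := lift_op2 quotient_group (@mul G).
Definition qinv := lift_op1 quotient_group (@inv G).
Definition qone : quotient_group := lift_cst quotient_group 1.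
Canonical pi_qone_morph := PiConst qone.

Lemma pi_qmul : {morph \pi_quotient_group : x y / x * y >-> qmul x y}.
Proof.
move=> x y; unlock qmul; apply/quotient_eqP; set x' := repr _; set y' := repr _.
have Nx : x / x' \in N by apply/quotient_eqP; rewrite reprK.
have Ny : y / y' \in N by apply/quotient_eqP; rewrite reprK.
have -> : x * y / (x' * y') = (y / y') ^ x^-1 * (x / x').
  by rewrite /conjg invgK invgM !mulgA mulgVK.
by rewrite gpredM ?gpred_conj.
Qed.
Canonical pi_qmul_morph := PiMorph2 pi_qmul.

Lemma pi_qinv : {morph \pi_quotient_group : x / x^-1 >-> qinv x}.
Proof.
move=> x; unlock qinv; apply/quotient_eqP; set x' := repr _.
have Nx : x' / x \in N by apply/quotient_eqP; rewrite reprK.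
have -> : x^-1 / x'^-1 = (x' / x) ^ x by rewrite /conjg !mulgVK invgK.
exact: gpred_conj.
Qed.
Canonical pi_qinv_morph := PiMorph1 pi_qinv.

Lemma qmulA : associative qmul.
Proof. by do 3!elim/quotW=> ?; rewrite !piE mulgA. Qed.
Lemma qmul1 : left_id qone qmul.
Proof. by elim/quotW=> ?; rewrite !piE mul1g. Qed.
Lemma qmulr1 : right_id qone qmul.
Proof. by elim/quotW=> ?; rewrite !piE mulg1. Qed.
Lemma qmulV : left_inverse qone qinv qmul.
Proof. by elim/quotW=> ?; rewrite !piE mulVg. Qed.
Lemma qmulrV : right_inverse qone qinv qmul.
Proof. by elim/quotW=> ?; rewrite !piE mulgV. Qed.

HB.instance Definition _ :=
  isGroup.Build quotient_group qmulA qmul1 qmulr1 qmulV qmulrV.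

End Quotient.

Section Predicates.
Variable G : groupType.

Definition full : {pred G} := predT.

HB.instance Definition _ := isMulClosed.Build G full (fun _ _ _ _ => isT).
HB.instance Definition _ := isMul1Closed.Build G full isT.
HB.instance Definition _ := isInvClosed.Build G full (fun _ _ => isT).
HB.instance Definition _ := isConjClosed.Build G full (fun _ _ _ => isT).

Definition center : {pred G} := fun x => `[< forall y : G, commute x y >].

Lemma centerP x : reflect (forall y, commute x y) (x \in center).
Proof. exact: asboolP. Qed.

Lemma center_mul : mulg_closed center.
Proof.
move=> x y /centerP xZ /centerP yZ; apply/centerP => z.
by apply/commute_sym/commuteM; apply/commute_sym.
Qed.
Lemma center_one : 1 \in center.
Proof. by apply/centerP => y; apply/commute_sym/commute1. Qed.
Lemma center_inv : invg_closed center.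
Proof.
move=> x /centerP xZ; apply/centerP => y.
by apply/commute_sym/commuteV/commute_sym.
Qed.
Lemma center_conj x y : x \in center -> x ^ y \in center.
Proof. by move=> xZ; have /centerP/(_ y)/commgP/conjg_fixP -> := xZ. Qed.

HB.instance Definition _ := isMulClosed.Build G center center_mul.
HB.instance Definition _ := isMul1Closed.Build G center center_one.
HB.instance Definition _ := isInvClosed.Build G center center_inv.
HB.instance Definition _ := isConjClosed.Build G center center_conj.

Section Meet.
Variables S T : groupClosed G.

Definition meet : {pred G} := fun x => (x \in S) && (x \in T).

Lemma meet_mul : mulg_closed meet.
Proof. by move=> x y /andP[? ?] /andP[? ?]; apply/andP; rewrite !gpredM. Qed.
Lemma meet_one : 1 \in meet.
Proof. by apply/andP; rewrite !gpred1. Qed.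
Lemma meet_inv : invg_closed meet.
Proof. by move=> x /andP[? ?]; apply/andP; rewrite !gpredVr. Qed.

HB.instance Definition _ := isMulClosed.Build G meet meet_mul.
HB.instance Definition _ := isMul1Closed.Build G meet meet_one.
HB.instance Definition _ := isInvClosed.Build G meet meet_inv.

End Meet.

Section Generated.
Variable A : {pred G}.

Definition generated_by : {pred G} :=
  fun x => `[< forall S : groupClosed G, {subset A <= S} -> x \in S >].

Lemma generated_byP x :
  reflect (forall S : groupClosed G, {subset A <= S} -> x \in S)
          (x \in generated_by).
Proof. exact: asboolP. Qed.

Lemma generated_mul : mulg_closed generated_by.
Proof.
move=> x y /generated_byP xA /generated_byP yA; apply/generated_byP => S AS.
by rewrite gpredM ?xA ?yA.
Qed.
Lemma generated_one : 1 \in generated_by.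
Proof. by apply/generated_byP => S _; apply: gpred1. Qed.
Lemma generated_inv : invg_closed generated_by.
Proof.
by move=> x /generated_byP xA; apply/generated_byP => S AS; rewrite gpredVr ?xA.
Qed.

HB.instance Definition _ := isMulClosed.Build G generated_by generated_mul.
HB.instance Definition _ := isMul1Closed.Build G generated_by generated_one.
HB.instance Definition _ := isInvClosed.Build G generated_by generated_inv.

Definition normal_closure : {pred G} :=
  fun x => `[< forall S : normalClosed G, {subset A <= S} -> x \in S >].

Lemma normal_closureP x :
  reflect (forall S : normalClosed G, {subset A <= S} -> x \in S)
          (x \in normal_closure).
Proof. exact: asboolP. Qed.

Lemma normal_closure_mul : mulg_closed normal_closure.
Proof.
move=> x y /normal_closureP xA /normal_closureP yA.
by apply/normal_closureP => S AS; rewrite gpredM ?xA ?yA.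
Qed.
Lemma normal_closure_one : 1 \in normal_closure.
Proof. by apply/normal_closureP => S _; apply: gpred1. Qed.
Lemma normal_closure_inv : invg_closed normal_closure.
Proof.
by move=> x /normal_closureP xA; apply/normal_closureP => S AS; rewrite gpredVr ?xA.
Qed.
Lemma normal_closure_conj x y : x \in normal_closure -> x ^ y \in normal_closure.
Proof.
by move=> /normal_closureP xA; apply/normal_closureP => S AS; rewrite gpred_conj ?xA.
Qed.

HB.instance Definition _ := isMulClosed.Build G normal_closure normal_closure_mul.
HB.instance Definition _ := isMul1Closed.Build G normal_closure normal_closure_one.
HB.instance Definition _ := isInvClosed.Build G normal_closure normal_closure_inv.
HB.instance Definition _ := isConjClosed.Build G normal_closure normal_closure_conj.

End Generated.

Section ConjPreimage.
Variables (S : groupClosed G) (y : G).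

Definition conj_preim : {pred G} := fun x => x ^ y \in S.

Lemma conj_preim_mul : mulg_closed conj_preim.
Proof. by move=> x z xS zS; rewrite unfold_in conjMg gpredM. Qed.
Lemma conj_preim_one : 1 \in conj_preim.
Proof. by rewrite unfold_in conj1g gpred1. Qed.
Lemma conj_preim_inv : invg_closed conj_preim.
Proof. by move=> x xS; rewrite unfold_in conjVg gpredVr. Qed.

HB.instance Definition _ := isMulClosed.Build G conj_preim conj_preim_mul.
HB.instance Definition _ := isMul1Closed.Build G conj_preim conj_preim_one.
HB.instance Definition _ := isInvClosed.Build G conj_preim conj_preim_inv.

End ConjPreimage.

Section Commutator.
Variables H K : normalClosed G.

Definition comm_set : {pred G} :=
  fun z => `[< exists x y, [/\ x \in H, y \in K & z = [~ x, y]] >].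

Definition comm_subgroup : {pred G} := generated_by comm_set.

HB.instance Definition _ := GroupClosed.on comm_subgroup.

Lemma comm_subgroup_conj x y : x \in comm_subgroup -> x ^ y \in comm_subgroup.
Proof.
move=> /generated_byP xHK.
apply: (xHK (conj_preim comm_subgroup y)) => z /asboolP[u [v [uH vK ->]]].
rewrite unfold_in conjRg; apply/generated_byP => S; apply.
by apply/asboolP; exists (u ^ y), (v ^ y); split; rewrite ?gpred_conj.
Qed.

HB.instance Definition _ := isConjClosed.Build G comm_subgroup comm_subgroup_conj.

End Commutator.

Section Restrict.
Variables (S : groupClosed G) (N : normalClosed G).

Definition restrict : {pred subgroup S} := fun u => val u \in N.

Lemma restrict_mul : mulg_closed restrict.
Proof. by move=> x y xN yN; rewrite unfold_in gmulfM gpredM. Qed.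
Lemma restrict_one : 1 \in restrict.
Proof. by rewrite unfold_in gmulf1 gpred1. Qed.
Lemma restrict_inv : invg_closed restrict.
Proof. by move=> x xN; rewrite unfold_in gmulfV gpredVr. Qed.
Lemma restrict_conj x y : x \in restrict -> x ^ y \in restrict.
Proof. by move=> xN; rewrite unfold_in gmulfJ gpred_conj. Qed.

HB.instance Definition _ := isMulClosed.Build (subgroup S) restrict restrict_mul.
HB.instance Definition _ := isMul1Closed.Build (subgroup S) restrict restrict_one.
HB.instance Definition _ := isInvClosed.Build (subgroup S) restrict restrict_inv.
HB.instance Definition _ := isConjClosed.Build (subgroup S) restrict restrict_conj.

End Restrict.

End Predicates.

Arguments full G : clear implicits.
Arguments center G : clear implicits.
Arguments restrict [G] S N.

Definition capable (G : groupType) : Prop :=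
  exists H : groupType, isomorphic G (quotient_group (center H)).

(* Free groups, as groups of reduced words in the letters x and x^-1, encoded
   as (x, true) and (x, false). *)

Section FreeGroup.
Variable X : choiceType.
Implicit Types (l : X * bool) (w : seq (X * bool)).

Definition inv_letter l := (l.1, ~~ l.2).

Definition reduced w := sorted (fun l m => m != inv_letter l) w.

Definition push l w :=
  if w is m :: w' then if m == inv_letter l then w' else l :: w else [:: l].

Definition word_mul u v := foldr push v u.

Definition word_inv w := rev (map inv_letter w).

Lemma inv_letterK : involutive inv_letter.
Proof. by case=> x b; rewrite /inv_letter negbK. Qed.

Lemma push_reduced l w : reduced w -> reduced (push l w).
Proof.
case: w => //= m w mw; case: eqP => [_|/eqP ml]; first exact: path_sorted mw.
by rewrite /= ml.
Qed.

Lemma pushK l w : reduced w -> push (inv_letter l) (push l w) = w.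
Proof.
case: w => [|m w] /=; first by rewrite inv_letterK eqxx.
case: eqP => [->|_ _]; last by rewrite /= inv_letterK eqxx.
by case: w => //= n w /andP[/negPf-> _].
Qed.

Lemma word_mul_reduced u v : reduced v -> reduced (word_mul u v).
Proof. by move=> rv; elim: u => //= l u; apply: push_reduced. Qed.

Lemma word_mul_push l u v :
  reduced v -> word_mul (push l u) v = push l (word_mul u v).
Proof.
move=> rv; case: u => [|m u] //=; case: eqP => [->|//].
have := pushK (inv_letter l) (word_mul_reduced u rv).
by rewrite inv_letterK => ->.
Qed.

Lemma word_mulA u v w :
  reduced w -> word_mul u (word_mul v w) = word_mul (word_mul u v) w.
Proof. by move=> rw; elim: u => //= l u ->; rewrite word_mul_push. Qed.

Lemma word_mul1 w : reduced w -> word_mul w [::] = w.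
Proof.
elim: w => //= l [|m w] //= IHw /andP[ml mw].
by rewrite IHw //= (negPf ml).
Qed.

Lemma word_invK : involutive word_inv.
Proof.
move=> w; rewrite /word_inv map_rev revK -map_comp map_id_in // => l _ /=.
exact: inv_letterK.
Qed.

Lemma word_mulV w : word_mul (word_inv w) w = [::].
Proof.
elim: w => // l w IHw.
rewrite /word_inv /= rev_cons /word_mul -cats1 foldr_cat /=.
by rewrite inv_letterK eqxx.
Qed.

Lemma word_inv_reduced w : reduced w -> reduced (word_inv w).
Proof.
rewrite /reduced /word_inv rev_sorted sorted_map; apply: sub_sorted => l m /=.
by rewrite inv_letterK eq_sym.
Qed.

Definition free_group : Type := {w : seq (X * bool) | reduced w}.

HB.instance Definition _ := SubChoice.on free_group.

Definition fg_one : free_group := exist _ [::] isT.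
Definition fg_mul (u v : free_group) : free_group :=
  exist _ (word_mul (val u) (val v)) (word_mul_reduced (val u) (valP v)).
Definition fg_inv (u : free_group) : free_group :=
  exist _ (word_inv (val u)) (word_inv_reduced (valP u)).

Lemma fg_mulA : associative fg_mul.
Proof. by move=> u v w; apply/val_inj/word_mulA/valP. Qed.
Lemma fg_mul1 : left_id fg_one fg_mul.
Proof. by move=> u; apply/val_inj. Qed.
Lemma fg_mulr1 : right_id fg_one fg_mul.
Proof. by move=> u; apply/val_inj/word_mul1/valP. Qed.
Lemma fg_mulV : left_inverse fg_one fg_inv fg_mul.
Proof. by move=> u; apply/val_inj/word_mulV. Qed.
Lemma fg_mulrV : right_inverse fg_one fg_inv fg_mul.
Proof.
by move=> u; apply/val_inj; rewrite /= -{1}[val u]word_invK; apply: word_mulV.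
Qed.

HB.instance Definition _ :=
  isGroup.Build free_group fg_mulA fg_mul1 fg_mulr1 fg_mulV fg_mulrV.

Definition fg_gen (x : X) : free_group := exist _ [:: (x, true)] isT.

Section Lift.
Variables (G : groupType) (f : X -> G).

Definition letter_val l := if l.2 then f l.1 else (f l.1)^-1.

Definition fg_lift (u : free_group) : G :=
  foldr (fun l g => letter_val l * g) 1 (val u).

Lemma fg_lift_mul : {morph fg_lift : u v / u * v}.
Proof.
move=> [u ru] [v rv]; rewrite /fg_lift /=.
elim: u {ru} => [|l u IHu] /=; first by rewrite mul1g.
rewrite -mulgA -{}IHu; case: (word_mul u v) => [|m w] //=.
case: eqP => //= ->; rewrite mulgA /letter_val /=.
by case: l.2 => /=; rewrite ?mulgV ?mulVg mul1g.
Qed.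

HB.instance Definition _ := isMultiplicative.Build free_group G fg_lift fg_lift_mul.

End Lift.

Section Universal.
Variables (G : groupType) (f : X -> G).

Lemma fg_lift_gen x : fg_lift f (fg_gen x) = f x.
Proof. exact: mulg1. Qed.

Lemma fg_lift_unique (h : {multiplicative free_group -> G}) :
  (forall x, h (fg_gen x) = f x) -> h =1 fg_lift f.
Proof.
move=> hf [w]; elim: w => [|[x b] w IHw] rw.
  by rewrite /fg_lift /= -(multiplicative1 h); congr (h _); apply/val_inj.
have rw' : reduced w by apply: path_sorted rw.
pose g : free_group := if b then fg_gen x else (fg_gen x)^-1.
have -> : exist _ ((x, b) :: w) rw = g * exist _ w rw' :> free_group.
  apply/val_inj; rewrite /g; case: b rw {g} => /=; case: w {IHw rw'} => //= m w;
  by move=> /andP[/negPf-> _].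
rewrite gmulfM [RHS]gmulfM IHw; congr (_ * _).
by rewrite /g; case: (b); rewrite ?multiplicativeV hf /= ?multiplicativeV fg_lift_gen.
Qed.

End Universal.

End FreeGroup.

Definition is_free (F : groupType) : Prop :=
  exists X : choiceType, isomorphic F (free_group X).

(* A relation u = v is given by the pair (u, v). *)
Definition presented (X : choiceType)
    (rels : seq (free_group X * free_group X)) : groupType :=
  quotient_group (normal_closure (mem [seq r.1 / r.2 | r <- rels])).

Definition gamma3 (F : groupType) : {pred F} :=
  comm_subgroup (comm_subgroup (full F) (full F)) (full F).
Arguments gamma3 F : clear implicits.

HB.instance Definition _ (F : groupType) := NormalClosed.on (gamma3 F).

Lemma comm_subgroup_sub (G : groupType) (H K H' K' : normalClosed G) :
  {subset H <= H'} -> {subset K <= K'} ->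
  {subset comm_subgroup H K <= comm_subgroup H' K'}.
Proof.
move=> sH sK x /generated_byP; apply=> z /asboolP[u [v [/sH uH /sK vK ->]]].
by apply/generated_byP => S; apply; apply/asboolP; exists u, v.
Qed.

Lemma comm_subgroup_subl (G : groupType) (H K : normalClosed G) :
  {subset comm_subgroup H K <= H}.
Proof.
move=> x /generated_byP; apply=> z /asboolP[u [v [uH _ ->]]].
by rewrite gpredM ?gpredVr ?gpred_conj.
Qed.

(* (R :&: gamma_3(F)) / [R, F, F]; the next lemma shows that restrict does not
   cut [R, F, F] down. *)
Definition presentation_multiplier (F : groupType) (R : normalClosed F) : groupType :=
  quotient_group
    (restrict (meet R (gamma3 F))
       (comm_subgroup (comm_subgroup R (full F)) (full F))).

Lemma comm_RFF_sub (F : groupType) (R : normalClosed F) :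
  {subset comm_subgroup (comm_subgroup R (full F)) (full F)
     <= meet R (gamma3 F)}.
Proof.
move=> x xRFF; apply/andP; split.
  exact/(@comm_subgroup_subl _ R (full F))/comm_subgroup_subl/xRFF.
by move: x xRFF; apply: comm_subgroup_sub => //; apply: comm_subgroup_sub.
Qed.

(* M^(2)(G) is defined up to isomorphism only, so it is specified by its
   isomorphism type, required of every free presentation of G. *)
Definition has_2nilpotent_multiplier (G A : groupType) : Prop :=
  forall (F : groupType) (R : normalClosed F),
    is_free F -> isomorphic G (quotient_group R) ->
    isomorphic (presentation_multiplier R) A.

Section Kernel.
Variables (G H : groupType) (f : {multiplicative G -> H}).

Definition kernel : {pred G} := fun x => f x == 1.

Lemma kernel_mul : mulg_closed kernel.
Proof. by move=> x y /eqP fx /eqP fy; rewrite unfold_in gmulfM fx fy mulg1. Qed.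
Lemma kernel_one : 1 \in kernel.
Proof. exact/eqP/multiplicative1. Qed.
Lemma kernel_inv : invg_closed kernel.
Proof. by move=> x /eqP fx; rewrite unfold_in multiplicativeV fx invg1. Qed.
Lemma kernel_conj x y : x \in kernel -> x ^ y \in kernel.
Proof.
by move=> /eqP fx; rewrite unfold_in !gmulfM fx mul1g multiplicativeV mulVg.
Qed.

HB.instance Definition _ := isMulClosed.Build G kernel kernel_mul.
HB.instance Definition _ := isMul1Closed.Build G kernel kernel_one.
HB.instance Definition _ := isInvClosed.Build G kernel kernel_inv.
HB.instance Definition _ := isConjClosed.Build G kernel kernel_conj.

End Kernel.

Lemma free_presentation (G : groupType) :
  exists F (R : normalClosed F), is_free F /\ isomorphic G (quotient_group R).
Proof.
pose f : {multiplicative free_group G -> G} := fg_lift id.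
have fE x : f (fg_gen x) = x := fg_lift_gen id x.
exists (free_group G), (kernel f : normalClosed (free_group G)); split.
  by exists G, idfun; exists idfun.
pose g (x : G) : quotient_group (kernel f) := \pi_(quotient_group (kernel f)) (fg_gen x).
have gM : {morph g : x y / x * y}.
  move=> x y; rewrite /g -[RHS]pi_qmul; apply/quotient_eqP/eqP.
  by rewrite !(gmulfM, multiplicativeV) !fE mulgV.
pose mg := isMultiplicative.Build _ _ g gM.
pose gm : {multiplicative _ -> _} := HB.pack g mg.
exists gm; exists (fun u => f (repr u)) => [x|u] /=.
  have /quotient_eqP/eqP : repr (g x) = fg_gen x %[mod quotient_group (kernel f)].
    by rewrite reprK.
  rewrite gmulfM multiplicativeV fE => /(canRL (mulgVK _)) ->.
  by rewrite mul1g.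
rewrite -[RHS]reprK; apply/quotient_eqP/eqP.
by rewrite gmulfM multiplicativeV fE mulgV.
Qed.

Definition fa : free_group bool := fg_gen false.
Definition fb : free_group bool := fg_gen true.

Local Notation a := fa.
Local Notation b := fb.

Definition K1 (p alpha beta gamma rho : nat) : groupType := presented
  [:: ([~ a, b] ^+ (p ^ gamma), 1); ([~ a, b, b], 1); ([~ a, b, a], 1);
      (b ^+ (p ^ beta), 1); (a ^+ (p ^ alpha), [~ a, b] ^+ (p ^ rho))].

Definition K2 (p alpha beta gamma : nat) : groupType := presented
  [:: (a ^+ (p ^ alpha), 1); (b ^+ (p ^ beta), 1);
      ([~ a, b] ^+ (p ^ gamma), 1); ([~ a, b, b], 1); ([~ a, b, a], 1)].

Definition K3 (p alpha beta gamma sigma : nat) : groupType := presented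
  [:: (a ^+ (p ^ alpha), 1); ([~ a, b] ^+ (p ^ gamma), 1);
      ([~ a, b, b], 1); ([~ a, b, a], 1);
      (b ^+ (p ^ beta), [~ a, b] ^+ (p ^ sigma))].

Definition K4 (p alpha beta gamma rho sigma : nat) : groupType := presented
  [:: ([~ a, b] ^+ (p ^ gamma), 1); ([~ a, b, b], 1); ([~ a, b, a], 1);
      (a ^+ (p ^ alpha), [~ a, b] ^+ (p ^ rho));
      (b ^+ (p ^ beta), [~ a, b] ^+ (p ^ sigma))].

Definition K5 (p alpha gamma rho : nat) : groupType := presented
  [:: ([~ a, b] ^+ (p ^ gamma), 1); ([~ a, b, b], 1); ([~ a, b, a], 1);
      (b ^+ (p ^ alpha), 1); (a ^+ (p ^ alpha), [~ a, b] ^+ (p ^ rho))].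

From mathcomp Require Import all_order all_algebra all_fingroup all_solvable.

(* The additive group of integers mod r, for r > 0; unlike 'Z_r it is trivial
   for r = 1. *)
Definition cyc (r : nat) : groupType := 'I_r.-1.+1.

(* Z_r^(t) *)
Definition cycn (r t : nat) : groupType := {ffun 'I_t -> cyc r}.

Definition dsum (A B : groupType) : groupType := (A * B)%type.

(* Main.v *)
(* Since G = F/R has class two, gamma_3(F) <= R and M^(2)(G) is
   gamma_3(F) / [R,F,F]; it does not depend on the presentation, so F may be
   taken free on a and b.  Modulo gamma_5(F) <= [R,F,F], the subgroup gamma_3(F)
   is free abelian on [c,a], [c,b], [c,a,a], [c,a,b], [c,b,b], where c = [a,b]:
   these five elements generate, and they are independent because gamma_2(F)
   maps onto Z[s,t]/(s,t)^3, with a and b acting as 1+s and 1+t, in an explicit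
   group structure on Q^8.  Evaluating [r,x,y] there for the defining relators r
   turns [R,F,F] into an explicit sublattice of Z^5, whose quotient is read off
   for each family. *)

Require Import Defs.
From HB Require Import structures.
From mathcomp Require Import all_boot all_order all_algebra all_fingroup all_solvable.
From mathcomp Require Import monoid generic_quotient boolp ring zify.

Import Defs.
Import Order.TTheory GRing.Theory Num.Theory.

Set Implicit Arguments.
Unset Strict Implicit.
Unset Printing Implicit Defensive.

Local Open Scope group_scope.
Local Open Scope quotient_scope.

(** * Commutators in infinite groups *)

(** The subgroup [R, F, F] is caught between two bounds. It lies in the lattice because a condition
    on all [r, x, y] cuts out a normal subgroup of elements r, so testing the relators against pairs
    of letters is enough; it exhausts the lattice because these same values span it. Both bounds are
    taken modulo gamma_5(F), which lies in [R, F, F] because gamma_3(F) <= R.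

    The oddness of p enters through the binomial coefficient of n over 2: for odd n it is a multiple
    of n, and the correction terms it brings are absorbed by the other relations. The shape of the
    answer is governed by the relation for b. If b^n = 1, the lattice is diagonal. If b^n = c^d,
    evaluating [b^n c^-d, a, a] ties the n-th power of [c, a] to the d-th power of [c, a, a], and
    this is what lets a cyclic factor of order larger than n appear. *)

Section GroupIdentities.
Variable G : groupType.
Implicit Types x y z : G.

Lemma commg_mull x y z : [~ x * y, z] = [~ x, z] ^ y * [~ y, z].
Proof. by rewrite /commg /conjg !gnorm. Qed.

Lemma commg_mulr x y z : [~ x, y * z] = [~ x, z] * [~ x, y] ^ z.
Proof. by rewrite /commg /conjg !gnorm. Qed.

Lemma commg_invl x y : [~ x^-1, y] = ([~ x, y]^-1) ^ x^-1.
Proof. by rewrite /commg /conjg !gnorm. Qed.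

Lemma commg_invr x y : [~ x, y^-1] = ([~ x, y]^-1) ^ y^-1.
Proof. by rewrite /commg /conjg !gnorm. Qed.

Lemma commg_conjl x y z : [~ x ^ z, y] = [~ x, y ^ z^-1] ^ z.
Proof. by rewrite conjRg -conjgM mulVg conjg1. Qed.

End GroupIdentities.

Section Morphism.
Variables (G H : groupType) (f : {multiplicative G -> H}).

Lemma multiplicativeJ x y : f (x ^ y) = f x ^ f y.
Proof. by rewrite /conjg !gmulfM multiplicativeV. Qed.

Lemma multiplicativeR x y : f [~ x, y] = [~ f x, f y].
Proof. by rewrite /commg gmulfM multiplicativeV multiplicativeJ. Qed.

Lemma multiplicativeX x n : f (x ^+ n) = f x ^+ n.
Proof.
elim: n => [|n IHn]; first by rewrite !expg0 multiplicative1.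
by rewrite !expgS gmulfM IHn.
Qed.

Section Preimage.
Variable S : groupClosed H.

Definition preimage : {pred G} := fun x => f x \in S.

Lemma preimage_mul : mulg_closed preimage.
Proof. by move=> x y xS yS; rewrite unfold_in gmulfM gpredM. Qed.
Lemma preimage_one : 1 \in preimage.
Proof. by rewrite unfold_in multiplicative1 gpred1. Qed.
Lemma preimage_inv : invg_closed preimage.
Proof. by move=> x xS; rewrite unfold_in multiplicativeV gpredVr. Qed.

HB.instance Definition _ := isMulClosed.Build G preimage preimage_mul.
HB.instance Definition _ := isMul1Closed.Build G preimage preimage_one.
HB.instance Definition _ := isInvClosed.Build G preimage preimage_inv.

End Preimage.

End Morphism.

Section CentralMod.
Variables (G : groupType) (S : normalClosed G).
Implicit Types x y z : G.

Definition central_mod : {pred G} := fun x => `[< forall y, [~ x, y] \in S >].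

Lemma central_modP x : reflect (forall y, [~ x, y] \in S) (x \in central_mod).
Proof. exact: asboolP. Qed.

Lemma central_mod_mul : mulg_closed central_mod.
Proof.
move=> x y /central_modP xS /central_modP yS; apply/central_modP => z.
by rewrite commg_mull gpredM ?gpred_conj.
Qed.
Lemma central_mod_one : 1 \in central_mod.
Proof. by apply/central_modP => y; rewrite comm1g gpred1. Qed.
Lemma central_mod_inv : invg_closed central_mod.
Proof.
move=> x /central_modP xS; apply/central_modP => z.
by rewrite commg_invl gpred_conj ?gpredVr.
Qed.
Lemma central_mod_conj x y : x \in central_mod -> x ^ y \in central_mod.
Proof.
move=> /central_modP xS; apply/central_modP => z.
by rewrite commg_conjl gpred_conj.
Qed.

HB.instance Definition _ := isMulClosed.Build G central_mod central_mod_mul.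
HB.instance Definition _ := isMul1Closed.Build G central_mod central_mod_one.
HB.instance Definition _ := isInvClosed.Build G central_mod central_mod_inv.
HB.instance Definition _ := isConjClosed.Build G central_mod central_mod_conj.

Section Commutant.
Variable x : G.

Definition commutant : {pred G} := fun y => [~ x, y] \in S.

Lemma commutant_mul : mulg_closed commutant.
Proof. by move=> y z yS zS; rewrite unfold_in commg_mulr gpredM ?gpred_conj. Qed.
Lemma commutant_one : 1 \in commutant.
Proof. by rewrite unfold_in commg1 gpred1. Qed.
Lemma commutant_inv : invg_closed commutant.
Proof. by move=> y yS; rewrite unfold_in commg_invr gpred_conj ?gpredVr. Qed.

HB.instance Definition _ := isMulClosed.Build G commutant commutant_mul.
HB.instance Definition _ := isMul1Closed.Build G commutant commutant_one.
HB.instance Definition _ := isInvClosed.Build G commutant commutant_inv.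

End Commutant.

(** This adjunction peels off one commutator at a time: an inclusion of [R, F, F] or of a lower
    central term becomes a condition on elements, which [central_mod2] then tests on the letters. *)
Lemma comm_subgroup_subP (R : normalClosed G) :
  {subset comm_subgroup R (full G) <= S} <-> {subset R <= central_mod}.
Proof.
split=> [RS x xR | RS x /generated_byP].
  apply/central_modP => y; apply: RS; apply/generated_byP => T; apply.
  by apply/asboolP; exists x, y.
by apply=> z /asboolP[u [v [uR _ ->]]]; exact: (central_modP _ (RS _ uR)).
Qed.

(* Factors central modulo S do not change a commutator modulo S. *)
Lemma commg_congr x y r s : r \in central_mod -> s \in central_mod ->
  [~ x, y]^-1 * [~ x * r, y * s] \in S.
Proof.
move=> /central_modP rS /central_modP sS.
rewrite commg_mull 2!commg_mulr.
have -> : [~ x, y]^-1 * (([~ x, s] * [~ x, y] ^ s) ^ r * ([~ r, s] * [~ r, y] ^ s))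
   = ([~ x, s] ^ r) ^ [~ x, y] * ([~ x, y]^-1 * ([~ x, y] ^ (s * r)))
       * ([~ r, s] * [~ r, y] ^ s).
  by rewrite conjgM conjMg /conjg !gnorm.
have xs : [~ x, s] \in S by rewrite -invgR; apply/gpredVr/sS.
have -> : [~ x, y]^-1 * [~ x, y] ^ (s * r) = [~ s * r, [~ x, y]]^-1.
  by rewrite [RHS]invgR -commgEl.
have sr : [~ s * r, [~ x, y]] \in S by rewrite commg_mull gpredM ?gpred_conj.
apply: gpredM; last by rewrite gpredM ?gpred_conj.
by apply: gpredM; [do 2!apply: gpred_conj | apply: gpredVr].
Qed.

End CentralMod.

Lemma comm_subgroup_mem (G : groupType) (H K : normalClosed G) x y :
  x \in H -> y \in K -> [~ x, y] \in comm_subgroup H K.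
Proof.
by move=> xH yK; apply/generated_byP => S; apply; apply/asboolP; exists x, y.
Qed.

Lemma comm_subgroup_ind (G : groupType) (H K : normalClosed G) (S : groupClosed G) :
  (forall x y, x \in H -> y \in K -> [~ x, y] \in S) ->
  {subset comm_subgroup H K <= S}.
Proof.
move=> HKS z /generated_byP; apply=> _ /asboolP[x [y [xH yK ->]]]; exact: HKS.
Qed.

Section SecondCenter.
Variable G : groupType.

(* If [r, x] and [r, y] are central then conjugation of r by x * y and by
   y * x give the same result. *)
Lemma second_center_commg (r x y : G) :
  (forall u v : G, [~ r, u, v] = 1) -> [~ r, [~ x, y]] = 1.
Proof.
move=> r2.
have rC u v : [~ r, u] ^ v = [~ r, u] by apply/conjg_fixP; rewrite r2.
have rJ u v : r ^ (u * v) = r * [~ r, v] * [~ r, u].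
  have rE w : r ^ w = r * [~ r, w] by rewrite commgEl mulVKg.
  by rewrite conjgM rE conjMg rC rE.
have rJC u v : r ^ (u * v) = r ^ (v * u).
  rewrite !rJ -2!(mulgA r); congr (_ * _).
  by rewrite [LHS]conjgC rC.
apply/eqP; rewrite commgEl -(inj_eq (@mulgI _ r)) mulVKg mulg1.
have -> : [~ x, y] = (x^-1 * y^-1) * (x * y) by rewrite /commg /conjg !gnorm.
rewrite conjgM rJC -conjgM.
by rewrite !gnorm conjg1.
Qed.

End SecondCenter.

Section ThreeSubgroups.
Variables (F : groupType) (R : normalClosed F).

Let RF : normalClosed F := comm_subgroup R (full F).
Let RFF : normalClosed F := comm_subgroup RF (full F).

Definition proj (N : normalClosed F) (x : F) : quotient_group N :=
  \pi_(quotient_group N) x.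

Lemma projM N : {morph proj N : x y / x * y}.
Proof. by move=> x y; rewrite /proj -[RHS]pi_qmul. Qed.

HB.instance Definition _ N := isMultiplicative.Build _ _ (proj N) (projM N).

Lemma proj_eq (N : normalClosed F) x y : (proj N x = proj N y) <-> x * y^-1 \in N.
Proof. by split=> [/quotient_eqP | xy]; last exact/quotient_eqP. Qed.

Lemma proj_eq1 (N : normalClosed F) x : (proj N x = 1) <-> x \in N.
Proof. by rewrite -(multiplicative1 (proj N)) proj_eq invg1 mulg1. Qed.

Lemma projW (N : normalClosed F) (P : quotient_group N -> Prop) :
  (forall x, P (proj N x)) -> forall y, P y.
Proof. by move=> Px; elim/quotW => x; apply: Px. Qed.

(** Modulo [RFF] the elements of [R] lie in the second centre, which commutes with the derived
    subgroup; this is an instance of the three subgroups lemma. *)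
Lemma commg_gamma2_mem r x :
  r \in R -> x \in comm_subgroup (full F) (full F) -> [~ r, x] \in RFF.
Proof.
move=> rR; move: x.
apply: (@comm_subgroup_ind _ _ _ (commutant RFF r)) => x y _ _.
rewrite unfold_in; apply/proj_eq1; rewrite 2!multiplicativeR.
apply: second_center_commg; elim/projW => u; elim/projW => v.
rewrite -!multiplicativeR; apply/proj_eq1.
by apply: comm_subgroup_mem => //; apply: comm_subgroup_mem.
Qed.

End ThreeSubgroups.

Section CongruentMaps.
Variables (F : groupType) (R : normalClosed F) (f : {multiplicative F -> F}).

Let RF : normalClosed F := comm_subgroup R (full F).
Let RFF : normalClosed F := comm_subgroup RF (full F).

Hypothesis fR : forall x, x^-1 * f x \in R.

Definition congruent (N : normalClosed F) : {pred F} := fun x => x^-1 * f x \in N.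

Lemma congruent_mul N : mulg_closed (congruent N).
Proof.
move=> x y xN yN; rewrite unfold_in gmulfM.
have -> : (x * y)^-1 * (f x * f y) = (x^-1 * f x) ^ y * (y^-1 * f y).
  by rewrite /conjg !gnorm.
by rewrite gpredM ?gpred_conj.
Qed.
Lemma congruent_one N : 1 \in congruent N.
Proof. by rewrite unfold_in multiplicative1 mulg1 invg1 gpred1. Qed.
Lemma congruent_inv N : invg_closed (congruent N).
Proof.
move=> x xN; rewrite unfold_in multiplicativeV.
have -> : x^-1^-1 * (f x)^-1 = ((x^-1 * f x)^-1) ^ x^-1 by rewrite /conjg !gnorm.
by rewrite gpred_conj ?gpredVr.
Qed.

HB.instance Definition _ N := isMulClosed.Build F (congruent N) (@congruent_mul N).
HB.instance Definition _ N := isMul1Closed.Build F (congruent N) (@congruent_one N).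
HB.instance Definition _ N := isInvClosed.Build F (congruent N) (@congruent_inv N).

(** Perturbing the entries of a commutator by [R] changes it by [RF], which settles gamma_2. For [u]
    in gamma_2, the perturbation of [u] lies in [RF] and is harmless modulo [RFF], but [v] moves by
    an [r] of [R]; the resulting [u, r] and [r, [u, v]] are commutators of [R] with gamma_2, hence
    in [RFF]. *)
Lemma gamma3_congr x : x \in gamma3 F -> x^-1 * f x \in RFF.
Proof.
have RcRF : {subset R <= central_mod RF} by exact: (comm_subgroup_subP RF R).1.
have RFcRFF : {subset RF <= central_mod RFF} by exact: (comm_subgroup_subP RFF RF).1.
have gamma2_congr u : u \in comm_subgroup (full F) (full F) -> u^-1 * f u \in RF.
  move: u; apply: (@comm_subgroup_ind _ _ _ (congruent RF)) => u v _ _.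
  rewrite unfold_in multiplicativeR -[f u](mulVKg u) -[f v](mulVKg v).
  by apply: commg_congr; apply: RcRF; apply: fR.
move: x; apply: (@comm_subgroup_ind _ _ _ (congruent RFF)) => u v uF _.
rewrite unfold_in multiplicativeR -[f u](mulVKg u) -[f v](mulVKg v).
set z := u^-1 * f u; set r := v^-1 * f v.
have rR : r \in R by apply: fR.
have zRF : z \in RF by apply: gamma2_congr.
have -> : [~ u, v]^-1 * [~ u * z, v * r]
    = [~ u, v]^-1 * [~ u, v * r] * ([~ u, v * r]^-1 * [~ u * z, v * r]).
  by rewrite !gnorm.
apply: gpredM; last first.
  rewrite -{2}[v * r]mulg1; apply: commg_congr; first exact: RFcRFF.
  exact: gpred1.
rewrite commg_mulr.
have -> : [~ u, v]^-1 * ([~ u, r] * [~ u, v] ^ r)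
    = [~ u, r] ^ [~ u, v] * [~ r, [~ u, v]]^-1.
  by rewrite invgR /commg /conjg !gnorm.
apply: gpredM; last first.
  apply/gpredVr/commg_gamma2_mem => //; exact: comm_subgroup_mem.
by apply: gpred_conj; rewrite -invgR; apply/gpredVr/commg_gamma2_mem.
Qed.

End CongruentMaps.

(** * Independence of the free presentation *)

Section Isomorphisms.

Lemma multiplicative_inv (G H : groupType) (f : {multiplicative G -> H}) g :
  cancel f g -> cancel g f -> exists h : {multiplicative H -> G}, h =1 g.
Proof.
move=> fK gK; pose m := isMultiplicative.Build _ _ g (can2_gmulfM fK gK).
by pose h : {multiplicative H -> G} := HB.pack g m; exists h.
Qed.

Lemma isomorphic_sym (G H : groupType) : isomorphic G H -> isomorphic H G.
Proof.
case=> f [g fK gK]; have [h hE] := multiplicative_inv fK gK.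
by exists h; exists f => x; rewrite hE.
Qed.

Lemma isomorphic_trans (G H K : groupType) :
  isomorphic G H -> isomorphic H K -> isomorphic G K.
Proof. by case=> f fB [g gB]; exists (g \o f); apply: bij_comp. Qed.

Lemma first_isomorphism (G A : groupType) (N : normalClosed G)
    (f : {multiplicative G -> A}) :
  (forall x, f x = 1 <-> x \in N) -> (forall y, exists x, f x = y) ->
  isomorphic (quotient_group N) A.
Proof.
move=> fN fS; pose g (q : quotient_group N) := f (repr q).
have gE x : g (proj N x) = f x.
  apply: divg1_eq; rewrite -multiplicativeV -gmulfM; apply/fN/proj_eq.
  by rewrite /proj reprK.
have gM : {morph g : x y / x * y}.
  by elim/projW => x; elim/projW => y; rewrite -gmulfM !gE gmulfM.
pose m := isMultiplicative.Build _ _ g gM.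
pose h : {multiplicative _ -> _} := HB.pack g m.
exists h; pose k y := proj N (projT1 (cid (fS y))).
exists k; rewrite /k /h /=.
  elim/projW => x; apply/proj_eq/fN; case: cid => y /=.
  by rewrite gE gmulfM multiplicativeV => ->; rewrite mulgV.
by move=> y; rewrite gE; case: cid.
Qed.

(** [f] is a plain function, multiplicative only where it matters, because the maps used below need
    not be homomorphisms on all of [F]. *)
Lemma multiplier_isomorphism (F A : groupType) (R : normalClosed F) (f : F -> A) :
  {in meet R (gamma3 F) &, {morph f : x y / x * y}} ->
  {in meet R (gamma3 F), forall x,
     f x = 1 <-> x \in comm_subgroup (comm_subgroup R (full F)) (full F)} ->
  (forall y, exists2 x, x \in meet R (gamma3 F) & f x = y) ->
  isomorphic (presentation_multiplier R) A.
Proof.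
move=> fM fK fS; pose g (u : subgroup (meet R (gamma3 F))) := f (val u).
have gM : {morph g : x y / x * y}.
  by move=> x y; rewrite /g gmulfM fM //; apply: valP.
pose m := isMultiplicative.Build _ _ g gM.
pose h : {multiplicative _ -> _} := HB.pack g m.
apply: (first_isomorphism (f := h)) => [u|y]; first exact/fK/valP.
by have [x xS <-] := fS y; exists (Sub x xS).
Qed.

End Isomorphisms.

Lemma free_lift (F H : groupType) (N : normalClosed H)
    (g : {multiplicative F -> quotient_group N}) :
  is_free F -> exists f : {multiplicative F -> H}, forall x, proj N (f x) = g x.
Proof.
case=> X [j [k jK kK]]; have [i iE] := multiplicative_inv jK kK.
pose h x := g (i (fg_gen x)); pose l : {multiplicative _ -> _} := fg_lift (repr \o h).
exists (l \o j) => x /=.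
rewrite -{2}[x]jK -iE.
rewrite -[LHS]/((proj N \o l) (j x)) -[RHS]/((g \o i) (j x)).
transitivity (fg_lift h (j x)); last first.
  by apply/esym/fg_lift_unique.
by apply: fg_lift_unique => y; rewrite /= fg_lift_gen /proj reprK.
Qed.

Section Independence.
Variables (F F' : groupType) (R : normalClosed F) (R' : normalClosed F').

Local Notation RFF := (comm_subgroup (comm_subgroup R (full F)) (full F)).
Local Notation RFF' := (comm_subgroup (comm_subgroup R' (full F')) (full F')).

Lemma comm_subgroup_image (f : {multiplicative F -> F'})
    (H K : normalClosed F) (H' K' : normalClosed F') :
  (forall x, x \in H -> f x \in H') -> (forall x, x \in K -> f x \in K') ->
  forall x, x \in comm_subgroup H K -> f x \in comm_subgroup H' K'.
Proof.
move=> fH fK; apply: (@comm_subgroup_ind _ _ _ (preimage f (comm_subgroup H' K'))).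
by move=> x y xH yK; rewrite unfold_in multiplicativeR comm_subgroup_mem ?fH ?fK.
Qed.

Lemma gamma3_image (f : {multiplicative F -> F'}) x : x \in gamma3 F -> f x \in gamma3 F'.
Proof. by move: x; apply: comm_subgroup_image => //; apply: comm_subgroup_image. Qed.

Lemma comm_RFF_image (f : {multiplicative F -> F'}) :
  (forall x, x \in R -> f x \in R') -> forall x, x \in RFF -> f x \in RFF'.
Proof.
by move=> fR; apply: comm_subgroup_image => //; apply: comm_subgroup_image.
Qed.

End Independence.

(** Freeness lifts the isomorphism of quotients and its inverse to [f] and [g]. The two composites
    are the identity modulo [R] and [R'], so by [gamma3_congr] they are the identity on gamma_3
    modulo [R, F, F] and its counterpart. *)
Lemma multiplier_independent (F F' : groupType)
    (R : normalClosed F) (R' : normalClosed F') :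
  is_free F -> is_free F' -> isomorphic (quotient_group R) (quotient_group R') ->
  isomorphic (presentation_multiplier R) (presentation_multiplier R').
Proof.
move=> freeF freeF' [q [q' qK q'K]]; have [k kE] := multiplicative_inv qK q'K.
have [f fE] := free_lift (q \o proj R) freeF.
have [g gE] := free_lift (k \o proj R') freeF'.
have fR x : x \in R -> f x \in R'.
  by move=> /proj_eq1 xR; apply/proj_eq1; rewrite fE /= xR multiplicative1.
have gR x : x \in R' -> g x \in R.
  by move=> /proj_eq1 xR; apply/proj_eq1; rewrite gE /= xR multiplicative1.
have gf x : x^-1 * (g \o f) x \in R.
  apply/proj_eq1; rewrite gmulfM multiplicativeV /= gE /= fE /= kE qK.
  exact: mulVg.
have fg x : x^-1 * (f \o g) x \in R'.
  apply/proj_eq1; rewrite gmulfM multiplicativeV /= fE /= gE /= kE q'K.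
  exact: mulVg.
pose S' := meet R' (gamma3 F').
have fS x : x \in meet R (gamma3 F) -> f x \in S'.
  by case/andP=> xR x3; apply/andP; rewrite fR ?gamma3_image.
pose N' := restrict S' (comm_subgroup (comm_subgroup R' (full F')) (full F')).
(* The default value 1 is taken only outside the intersection of [R] with gamma_3, where [h] is
   irrelevant. *)
pose h x : presentation_multiplier R' := proj N' (insubd (1 : subgroup S') (f x)).
apply: (multiplier_isomorphism (f := h)) => [x y xS yS|x xS|].
- rewrite /h -gmulfM; congr (proj _ _); apply: val_inj.
  rewrite [LHS]insubdK ?fS ?gpredM // [RHS]gmulfM gmulfM.
  by apply: (congr2 mul); apply/esym/insubdK/fS.
- split=> [/proj_eq1 | xR]; last first.
    apply/proj_eq1; rewrite unfold_in insubdK ?fS //.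
    exact: (comm_RFF_image fR).
  rewrite unfold_in insubdK ?fS // => /(comm_RFF_image gR) gfx.
  have /andP[_ /(gamma3_congr gf)] := xS.
  by rewrite gpredMr //= gpredV.
elim/projW => -[y yS']; have /andP[yR y3] := yS'.
exists (g y); first by apply/andP; rewrite gR ?gamma3_image.
have fgS : f (g y) \in S' by apply/andP; rewrite fR ?gR ?gamma3_image.
apply/proj_eq; rewrite unfold_in gmulfM multiplicativeV -[X in X * _]/(val _).
rewrite insubdK //.
by have := gpred_conj _ y^-1 (gamma3_congr fg y3); rewrite /conjg !gnorm.
Qed.

(** * Generators of gamma_3 modulo gamma_5 *)

Section IntegerPowers.
Variable G : groupType.
Implicit Types (x : G) (i j k : int).

Definition expz x k : G := match k with Posz n => x ^+ n | Negz n => x ^- n.+1 end.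

Lemma expzS x k : expz x (k + 1)%R = expz x k * x.
Proof.
case: k => [n|[|n]].
- have -> : (n%:Z + 1)%R = n.+1 by lia.
  by rewrite /= expgSr.
- by rewrite /= mulVg.
have -> : (Negz n.+1 + 1)%R = Negz n by rewrite !NegzE; lia.
by rewrite /= (expgS _ n.+1) invgM mulgVK.
Qed.

Lemma expzB1 x k : expz x (k - 1)%R = expz x k * x^-1.
Proof. by rewrite -[k in RHS](GRing.subrK 1%R) expzS mulgK. Qed.

Lemma expzD x i j : expz x (i + j)%R = expz x i * expz x j.
Proof.
elim/int_rec: j => [|n IHn|n IHn]; first by rewrite GRing.addr0 mulg1.
  have -> : (i + n.+1%:Z = i + n%:Z + 1)%R by lia.
  by have -> : (n.+1%:Z = n%:Z + 1)%R; [lia | rewrite !expzS IHn mulgA].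
have -> : (i - n.+1%:Z = i - n%:Z - 1)%R by lia.
have -> : (- n.+1%:Z = - n%:Z - 1)%R by lia.
by rewrite !expzB1 IHn mulgA.
Qed.

Lemma expzN x k : expz x (- k)%R = (expz x k)^-1.
Proof. by apply/esym/mulg1_eq; rewrite -expzD GRing.subrr. Qed.

Lemma expz_hom (h : int -> G) : (forall i j, h (i + j)%R = h i * h j) ->
  forall k, expz (h 1%R) k = h k.
Proof.
move=> hD; have h0 : h 0%R = 1 by apply: (mulgI (h 0%R)); rewrite -hD mulg1.
have hS k : h (k - 1)%R = h k * (h 1%R)^-1.
  by apply: (mulIg (h 1%R)); rewrite mulgVK -hD GRing.subrK.
elim/int_rec=> [|n IHn|n IHn]; first by [].
  by rewrite -addn1 PoszD expzS IHn hD.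
have -> : (- n.+1%:Z = - n%:Z - 1)%R by lia.
by rewrite expzB1 IHn hS.
Qed.

Lemma expz_mem (S : groupClosed G) x k : x \in S -> expz x k \in S.
Proof. by case: k => n xS /=; rewrite ?gpredVr ?gpredXn. Qed.

End IntegerPowers.

Lemma multiplicativeZ (G H : groupType) (f : {multiplicative G -> H}) x k :
  f (expz x k) = expz (f x) k.
Proof. by case: k => n; rewrite /= ?multiplicativeV multiplicativeX. Qed.

(** Powers of [z] times elements of [S] already form a normal subgroup. Adjoining generators one by
    one in this way produces normal forms. *)
Lemma adjoin_central (G : groupType) (S : normalClosed G) z : z \in central_mod S ->
  exists T : normalClosed G, [/\ {subset S <= T}, z \in T & forall x,
    x \in T -> exists k s, s \in S /\ x = expz z k * s].
Proof.
move=> zS; pose T : {pred G} := fun x => `[< exists k s, s \in S /\ x = expz z k * s >].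
have TP x : x \in T <-> exists k s, s \in S /\ x = expz z k * s.
  by split=> [/asboolP|xT] //; apply/asboolP.
have Tmul : mulg_closed T.
  move=> _ _ /TP[i [s [sS ->]]] /TP[j [t [tS ->]]]; apply/TP.
  exists (i + j)%R, (s ^ expz z j * t); rewrite gpredM ?gpred_conj //; split=> //.
  rewrite expzD (mulgA (expz z i * s)) -(mulgA (expz z i) s) (conjgC s).
  by move: (s ^ _) => s'; rewrite !mulgA.
have Tone : 1 \in T by apply/TP; exists 0%R, 1; rewrite gpred1 mulg1.
have Tinv : invg_closed T.
  move=> _ /TP[i [s [sS ->]]]; apply/TP.
  exists (- i)%R, (s^-1 ^ expz z (- i)%R); rewrite gpred_conj ?gpredVr //; split=> //.
  by rewrite -conjgC expzN invgM.
have Tconj x y : x \in T -> x ^ y \in T.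
  move=> /TP[i [s [sS ->]]]; apply/TP.
  exists i, ([~ expz z i, y] * s ^ y); split; last first.
    by rewrite conjMg commgEl -(mulgA (expz z i)^-1) mulVKg.
  by rewrite gpredM ?gpred_conj //; exact: (central_modP _ _ (expz_mem i zS)).
pose m1 := isMulClosed.Build G T Tmul; pose m2 := isMul1Closed.Build G T Tone.
pose m3 := isInvClosed.Build G T Tinv; pose m4 := isConjClosed.Build G T Tconj.
pose N : normalClosed G := HB.pack T m1 m2 m3 m4; exists N; split=> [x xS||x /TP//].
  by apply/TP; exists 0%R, x; rewrite mul1g.
by apply/TP; exists 1%R, 1; rewrite mulg1 gpred1.
Qed.

Lemma central_mod_sub (G : groupType) (S T : normalClosed G) :
  {subset S <= T} -> {subset central_mod S <= central_mod T}.
Proof. by move=> ST x /central_modP xS; apply/central_modP => y; apply/ST. Qed.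

Section Rank2.
Local Notation F := (free_group bool).
Local Notation a := fa.
Local Notation b := fb.
Local Notation c := [~ a, b].
Local Notation gamma2 := (comm_subgroup (full F) (full F)).
Local Notation gamma4 := (comm_subgroup (gamma3 F) (full F)).
Local Notation gamma5 := (comm_subgroup gamma4 (full F)).

Lemma free_group2_ind (S : groupClosed F) : a \in S -> b \in S -> forall x, x \in S.
Proof.
move=> aS bS [w]; elim: w => [|[x e] w IHw] rw.
  by have -> : exist _ [::] rw = 1 :> F; [apply: val_inj | apply: gpred1].
have rw' : reduced w by apply: path_sorted rw.
pose g : F := if e then fg_gen x else (fg_gen x)^-1.
have -> : exist _ ((x, e) :: w) rw = g * exist _ w rw' :> F.
  apply/val_inj; rewrite /g; case: e rw {g} => /=; case: w {IHw rw'} => //= m w;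
  by move=> /andP[/negPf-> _].
have gS : fg_gen x \in S by case: x {rw g}.
by rewrite gpredM ?IHw // /g; case: (e); rewrite ?gpredVr.
Qed.

Lemma central_mod2 (S : normalClosed F) x :
  [~ x, a] \in S -> [~ x, b] \in S -> x \in central_mod S.
Proof.
by move=> xa xb; apply/central_modP; apply: (@free_group2_ind (commutant S x)).
Qed.

(** A quotient in which the two generators commute is abelian. *)
Lemma full_central_mod (S : normalClosed F) : c \in S -> forall x, x \in central_mod S.
Proof.
move=> cS; apply: free_group2_ind; apply: central_mod2; rewrite ?commgg ?gpred1 //.
by rewrite -invgR gpredVr.
Qed.

(* Both sides are the value of [c ^ (a * b)], up to the central factor
   coming from [a * b = b * a * c]. *)
Lemma commg_cba : [~ c, b, a]^-1 * [~ c, a, b] \in gamma5.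
Proof.
have cg : c \in gamma2 by apply: comm_subgroup_mem.
have cx3 y : [~ c, y] \in gamma3 F by apply: comm_subgroup_mem.
have cxy4 y z : [~ c, y, z] \in gamma4 by apply: comm_subgroup_mem.
pose P := proj gamma5 : {multiplicative F -> _}.
have comm_P x y : [~ x, y] \in gamma5 -> P x ^ P y = P x.
  by move=> xy; apply/conjg_fixP; rewrite -multiplicativeR; apply/eqP/proj_eq1.
have w_central y z t : P [~ c, y, z] ^ P t = P [~ c, y, z].
  exact/comm_P/comm_subgroup_mem.
have uc y : P [~ c, y] ^ P c = P [~ c, y].
  by apply/comm_P/commg_gamma2_mem.
have uv : P [~ c, a] * P [~ c, b] = P [~ c, b] * P [~ c, a].
  rewrite [LHS]conjgC; congr (_ * _); apply/comm_P/commg_gamma2_mem => //.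
  exact: comm_subgroup_mem.
have conjP x y : P x ^ P y = P x * P [~ x, y].
  by rewrite -gmulfM -multiplicativeJ commgEl mulVKg.
have cab : P c ^ (P a * P b) = P c * P [~ c, b] * (P [~ c, a] * P [~ c, a, b]).
  by rewrite conjgM conjP conjMg !conjP.
have cba : P c ^ (P b * P a) = P c * P [~ c, a] * (P [~ c, b] * P [~ c, b, a]).
  by rewrite conjgM conjP conjMg !conjP.
have abc : P a * P b = P b * P a * P c.
  by rewrite -!gmulfM; congr (P _); apply: commgC.
have : P c ^ (P a * P b) = P c ^ (P b * P a).
  rewrite abc conjgM cba !conjMg !uc w_central; congr (_ * _ * _).
  by rewrite /conjg mulgA mulVg mul1g.
rewrite cab cba -2!(mulgA (P c)) => /mulgI.
rewrite [in RHS]mulgA uv -mulgA => /mulgI/mulgI wE.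
by apply/proj_eq1; rewrite gmulfM multiplicativeV -/P wE mulVg.
Qed.

Definition basis_word (i j k l m : int) : F :=
  expz [~ c, a] i * (expz [~ c, b] j * (expz [~ c, a, a] k *
    (expz [~ c, a, b] l * expz [~ c, b, b] m))).

Lemma gamma3_expansion x : x \in gamma3 F ->
  exists i j k l m z, z \in gamma5 /\ x = basis_word i j k l m * z.
Proof.
have mem2 y : y \in gamma2 -> y \in central_mod (gamma3 F).
  by move: y; apply: (comm_subgroup_subP _ _).1 => z zN; exact: zN.
have mem3 y : y \in gamma3 F -> y \in central_mod gamma4.
  by move: y; apply: (comm_subgroup_subP _ _).1 => z zN; exact: zN.
have mem4 y : y \in gamma4 -> y \in central_mod gamma5.
  by move: y; apply: (comm_subgroup_subP _ _).1 => z zN; exact: zN.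
have cg : c \in gamma2 by apply: comm_subgroup_mem.
have cx3 y : [~ c, y] \in gamma3 F by apply: comm_subgroup_mem.
have cxy4 y z : [~ c, y, z] \in gamma4 by apply: comm_subgroup_mem.
have sub5 : {subset gamma5 <= gamma4} by exact: comm_subgroup_subl.
have [W [sW cW WE]] := adjoin_central (mem2 c cg).
have gW : {subset gamma2 <= W}.
  by apply/(comm_subgroup_subP W (full F)) => y _; apply: full_central_mod.
(* Generators are adjoined in the reverse of their order in [basis_word], since each new power is
   placed on the left. *)
have [V1 [sV1 vV1 V1E]] := adjoin_central (mem3 _ (cx3 b)).
have [V2 [sV2 uV2 V2E]] := adjoin_central (central_mod_sub sV1 (mem3 _ (cx3 a))).
have gV2 : {subset gamma3 F <= V2}.
  apply/(comm_subgroup_subP V2 gamma2) => y /gW/WE[k [s [s3 ->]]].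
  apply: gpredM; first by apply/expz_mem/central_mod2; rewrite ?uV2 // sV2.
  by apply/(central_mod_sub sV2)/(central_mod_sub sV1)/mem3.
have [U1 [sU1 wU1 U1E]] := adjoin_central (mem4 _ (cxy4 b b)).
have [U2 [sU2 wU2 U2E]] := adjoin_central (central_mod_sub sU1 (mem4 _ (cxy4 a b))).
have [U3 [sU3 wU3 U3E]] := adjoin_central
  (central_mod_sub sU2 (central_mod_sub sU1 (mem4 _ (cxy4 a a)))).
have uU3 : [~ c, a] \in central_mod U3 by apply: central_mod2; rewrite ?wU3 // sU3.
have vU3 : [~ c, b] \in central_mod U3.
  apply: central_mod2; last exact/sU3/sU2.
  have := sU3 _ (sU2 _ (sU1 _ commg_cba)).
  by rewrite gpredMr ?gpredV // sU3.
have gU3 : {subset gamma4 <= U3}.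
  apply/(comm_subgroup_subP U3 (gamma3 F)) => y /gV2/V2E[i [s [/V1E[j [t [t4 ->]]] ->]]].
  rewrite !gpredM ?expz_mem //.
  by apply/(central_mod_sub sU3)/(central_mod_sub sU2)/(central_mod_sub sU1)/mem4.
move=> /gV2/V2E[i [_ [/V1E[j [t [/gU3/U3E t4 ->]]] ->]]].
have [k [_ [/U2E[l [_ [/U1E[m [z [z5 ->]]] ->]]] ->]]] := t4.
exists i, j, k, l, m, z; split=> //; rewrite /basis_word.
move: (expz _ i) (expz _ j) (expz _ k) (expz _ l) (expz _ m) => *.
by rewrite !mulgA.
Qed.

End Rank2.

(** * A group realizing the class-four quotient *)

Section Model.
Local Open Scope ring_scope.

(** Rational coordinates turn binomial coefficients into polynomials, so the group laws become field
    identities; [lattice_point] singles out the integral points needed. *)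
Definition model : Type := (rat * rat * rat * rat * rat * rat * rat * rat)%type.

HB.instance Definition _ := Choice.on model.

Definition choose2 (x : rat) : rat := x * (x - 1) / 2%:R.
Definition choose3 (x : rat) : rat := x * (x - 1) * (x - 2%:R) / 6%:R.

(* (i, j, f0, ..., f5) stands for a^i b^j c^f, where c^f is the action on c of
   f = f0 + f1 s + f2 t + f3 s^2 + f4 s t + f5 t^2 in Q[s,t]/(s,t)^3 and a, b act
   by conjugation as x = 1 + s and y = 1 + t.  Moving a^k to the left of b^j
   costs c to the power - (x^k - 1)/(x - 1) * (y^j - 1)/(y - 1). *)
Definition model_mul (x y : model) : model :=
  let: (i, j, f0, f1, f2, f3, f4, f5) := x in
  let: (k, l, g0, g1, g2, g3, g4, g5) := y in
  let jl := choose2 j + j * l in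
  (i + k, j + l,
   f0 + g0 - k * j,
   f1 + k * f0 + g1 - choose2 k * j,
   f2 + l * f0 + g2 - k * jl,
   f3 + k * f1 + choose2 k * f0 + g3 - choose3 k * j,
   f4 + k * f2 + l * f1 + k * l * f0 + g4 - choose2 k * jl,
   f5 + l * f2 + choose2 l * f0 + g5 - k * (choose3 j + choose2 j * l + j * choose2 l)).

Definition model_one : model := (0, 0, 0, 0, 0, 0, 0, 0).

(** The last six coordinates of the right factor enter a product only by addition, so negating what
    remains of x a^-i b^-j completes the inverse. *)
Definition model_inv (x : model) : model :=
  let: (i, j, f0, f1, f2, f3, f4, f5) := x in
  let: (_, _, g0, g1, g2, g3, g4, g5) :=
    model_mul x (- i, - j, 0, 0, 0, 0, 0, 0) in
  (- i, - j, - g0, - g1, - g2, - g3, - g4, - g5).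

Lemma model_eq (x0 x1 x2 x3 x4 x5 x6 x7 y0 y1 y2 y3 y4 y5 y6 y7 : rat) :
  x0 = y0 -> x1 = y1 -> x2 = y2 -> x3 = y3 -> x4 = y4 -> x5 = y5 -> x6 = y6 ->
  x7 = y7 -> (x0, x1, x2, x3, x4, x5, x6, x7) = (y0, y1, y2, y3, y4, y5, y6, y7).
Proof. by do 8!move=> ->. Qed.

Lemma model_mulA : associative model_mul.
Proof.
move=> [[[[[[[i j] f0] f1] f2] f3] f4] f5] [[[[[[[k l] g0] g1] g2] g3] g4] g5].
move=> [[[[[[[m n] h0] h1] h2] h3] h4] h5].
by apply: model_eq; rewrite /choose2 /choose3; field.
Qed.
Lemma model_mul1 : left_id model_one model_mul.
Proof.
move=> [[[[[[[i j] f0] f1] f2] f3] f4] f5].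
by apply: model_eq; rewrite /choose2 /choose3; field.
Qed.
Lemma model_mulr1 : right_id model_one model_mul.
Proof.
move=> [[[[[[[i j] f0] f1] f2] f3] f4] f5].
by apply: model_eq; rewrite /choose2 /choose3; field.
Qed.
Lemma model_mulrV : right_inverse model_one model_inv model_mul.
Proof.
move=> [[[[[[[i j] f0] f1] f2] f3] f4] f5].
by apply: model_eq; rewrite /choose2 /choose3; field.
Qed.
Lemma model_mulV : left_inverse model_one model_inv model_mul.
Proof.
move=> [[[[[[[i j] f0] f1] f2] f3] f4] f5].
by apply: model_eq; rewrite /choose2 /choose3; field.
Qed.

HB.instance Definition _ :=
  isGroup.Build model model_mulA model_mul1 model_mulr1 model_mulV model_mulrV.

Ltac model_field := apply: model_eq; rewrite /choose2 /choose3; field.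

Definition derived (f0 f1 f2 f3 f4 f5 : rat) : model := (0, 0, f0, f1, f2, f3, f4, f5).

(** Commutators in the model are thus computed from products alone, without expanding inverses. *)
Lemma commg_unique (G : groupType) (x y z : G) :
  (x * y = y * x * z)%g -> ([~ x, y] = z)%g.
Proof. by rewrite commgC => /mulgI. Qed.

(** The exponent on the right is f times (1 + s)^k (1 + t)^l - 1, truncated above degree two. *)
Lemma commg_derived f0 f1 f2 f3 f4 f5 (k l g0 g1 g2 g3 g4 g5 : rat) :
  [~ derived f0 f1 f2 f3 f4 f5, ((k, l, g0, g1, g2, g3, g4, g5) : model)]%g =
  derived 0 (k * f0) (l * f0) (k * f1 + choose2 k * f0)
    (k * f2 + l * f1 + k * l * f0) (l * f2 + choose2 l * f0).
Proof. by apply: commg_unique; model_field. Qed.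

Definition ma : model := (1, 0, 0, 0, 0, 0, 0, 0).
Definition mb : model := (0, 1, 0, 0, 0, 0, 0, 0).

Lemma commg_ma_mb : [~ ma, mb]%g = derived 1 0 0 0 0 0.
Proof. by apply: commg_unique; model_field. Qed.

Lemma commg_apower_a (m k : rat) :
  [~ ((m, 0, k, 0, 0, 0, 0, 0) : model), ma]%g = derived 0 k 0 0 0 0.
Proof. by apply: commg_unique; model_field. Qed.

(** The exponent is ((1 + s)^m - 1)/s + k t. *)
Lemma commg_apower_b (m k : rat) :
  [~ ((m, 0, k, 0, 0, 0, 0, 0) : model), mb]%g =
  derived m (choose2 m) k (choose3 m) 0 0.
Proof. by apply: commg_unique; model_field. Qed.

(** The exponent is k s - ((1 + t)^n - 1)/t. *)
Lemma commg_bpower_a (n k : rat) :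
  [~ ((0, n, k, 0, 0, 0, 0, 0) : model), ma]%g =
  derived (- n) k (- choose2 n) 0 0 (- choose3 n).
Proof. by apply: commg_unique; model_field. Qed.

Lemma commg_bpower_b (n k : rat) :
  [~ ((0, n, k, 0, 0, 0, 0, 0) : model), mb]%g = derived 0 0 k 0 0 0.
Proof. by apply: commg_unique; model_field. Qed.

Lemma derivedM (f0 f1 f2 f3 f4 f5 g0 g1 g2 g3 g4 g5 : rat) :
  (derived f0 f1 f2 f3 f4 f5 * derived g0 g1 g2 g3 g4 g5)%g =
  derived (f0 + g0) (f1 + g1) (f2 + g2) (f3 + g3) (f4 + g4) (f5 + g5).
Proof. by model_field. Qed.

Lemma expg_ma n : (ma ^+ n)%g = (n%:R, 0, 0, 0, 0, 0, 0, 0).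
Proof. by elim: n => // n IHn; rewrite expgSr IHn -natr1; model_field. Qed.

Lemma expg_mb n : (mb ^+ n)%g = (0, n%:R, 0, 0, 0, 0, 0, 0).
Proof. by elim: n => // n IHn; rewrite expgSr IHn -natr1; model_field. Qed.

Lemma expg_derived0 n : (derived 1 0 0 0 0 0 ^+ n)%g = derived n%:R 0 0 0 0 0.
Proof.
by elim: n => // n IHn; rewrite expgSr IHn derivedM -natr1; congr derived; ring.
Qed.

Definition lattice_point (i j k l m : int) : model :=
  derived 0 i%:~R j%:~R k%:~R l%:~R m%:~R.

Lemma lattice_pointM i j k l m i' j' k' l' m' :
  (lattice_point i j k l m * lattice_point i' j' k' l' m')%g =
  lattice_point (i + i') (j + j') (k + k') (l + l') (m + m').
Proof. by rewrite /lattice_point derivedM !intrD addr0. Qed.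

Lemma lattice_pointZ i j k l m n :
  expz (lattice_point i j k l m) n =
  lattice_point (i * n) (j * n) (k * n) (l * n) (m * n).
Proof.
pose h n := lattice_point (i * n) (j * n) (k * n) (l * n) (m * n).
have -> : lattice_point i j k l m = h 1 by rewrite /h !mulr1.
by apply: expz_hom => x y; rewrite /h lattice_pointM !mulrDr.
Qed.

Lemma lattice_point_inj i j k l m i' j' k' l' m' :
  lattice_point i j k l m = lattice_point i' j' k' l' m' ->
  [/\ i = i', j = j', k = k', l = l' & m = m'].
Proof. by case=> *; split; apply: (@intr_inj rat). Qed.

End Model.

Arguments choose2 x%_R.
Arguments derived (f0 f1 f2 f3 f4 f5)%_R.
Arguments lattice_point (i j k l m)%_R.

(** * Evaluation of the free group in the model *)

Section Evaluation.
Local Notation F := (free_group bool).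
Local Notation a := fa.
Local Notation b := fb.
Local Notation c := [~ a, b].
Local Notation gamma2 := (comm_subgroup (full F) (full F)).
Local Notation gamma4 := (comm_subgroup (gamma3 F) (full F)).
Local Notation gamma5 := (comm_subgroup gamma4 (full F)).

Definition eval : {multiplicative F -> model} :=
  fg_lift (fun x : bool => if x then mb else ma).

Lemma eval_a : eval a = ma. Proof. exact: fg_lift_gen. Qed.
Lemma eval_b : eval b = mb. Proof. exact: fg_lift_gen. Qed.
Lemma eval_c : eval c = derived 1 0 0 0 0 0.
Proof. by rewrite multiplicativeR eval_a eval_b commg_ma_mb. Qed.

Lemma choose2_0 : choose2 0 = 0%R. Proof. by []. Qed.
Lemma choose2_1 : choose2 1 = 0%R. Proof. by []. Qed.

Definition model_simp :=
  (choose2_0, choose2_1, mulr0, mul0r, mulr1, mul1r, addr0, add0r).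

Lemma commg_derived_a f0 f1 f2 f3 f4 f5 :
  [~ derived f0 f1 f2 f3 f4 f5, ma] = derived 0 f0 0 f1 f2 0.
Proof. by rewrite /ma commg_derived !model_simp. Qed.

Lemma commg_derived_b f0 f1 f2 f3 f4 f5 :
  [~ derived f0 f1 f2 f3 f4 f5, mb] = derived 0 0 f0 0 f1 f2.
Proof. by rewrite /mb commg_derived !model_simp. Qed.

Lemma eval_commg_a x f0 f1 f2 f3 f4 f5 : eval x = derived f0 f1 f2 f3 f4 f5 ->
  eval [~ x, a] = derived 0 f0 0 f1 f2 0.
Proof. by move=> xE; rewrite multiplicativeR xE eval_a commg_derived_a. Qed.

Lemma eval_commg_b x f0 f1 f2 f3 f4 f5 : eval x = derived f0 f1 f2 f3 f4 f5 ->
  eval [~ x, b] = derived 0 0 f0 0 f1 f2.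
Proof. by move=> xE; rewrite multiplicativeR xE eval_b commg_derived_b. Qed.

(** A commutator with a letter multiplies the exponent of [c] by s or t, so the eight commutators of
    [c] with three letters vanish in Q[s,t]/(s,t)^3. *)
Lemma eval_gamma5 x : x \in gamma5 -> eval x = 1.
Proof.
suff K5 : {subset gamma5 <= kernel eval} by move=> /K5/eqP.
have kerP y : eval y = 1 -> y \in kernel eval by move/eqP.
apply/(comm_subgroup_subP (kernel eval) gamma4).
apply/(comm_subgroup_subP (central_mod (kernel eval)) (gamma3 F)).
apply/(comm_subgroup_subP (central_mod (central_mod (kernel eval))) gamma2).
apply/(comm_subgroup_subP
  (central_mod (central_mod (central_mod (kernel eval)))) (full F)).
move=> y _; apply: full_central_mod.
do 3!apply: central_mod2; apply: kerP.
- exact: (eval_commg_a (eval_commg_a (eval_commg_a eval_c))).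
- exact: (eval_commg_b (eval_commg_a (eval_commg_a eval_c))).
- exact: (eval_commg_a (eval_commg_b (eval_commg_a eval_c))).
- exact: (eval_commg_b (eval_commg_b (eval_commg_a eval_c))).
- exact: (eval_commg_a (eval_commg_a (eval_commg_b eval_c))).
- exact: (eval_commg_b (eval_commg_a (eval_commg_b eval_c))).
- exact: (eval_commg_a (eval_commg_b (eval_commg_b eval_c))).
- exact: (eval_commg_b (eval_commg_b (eval_commg_b eval_c))).
Qed.

Lemma eval_basis i j k l m :
  eval (basis_word i j k l m) = lattice_point i j k l m.
Proof.
have uE : eval [~ c, a] = lattice_point 1 0 0 0 0 by apply: eval_commg_a eval_c.
have vE : eval [~ c, b] = lattice_point 0 1 0 0 0 by apply: eval_commg_b eval_c.
rewrite /basis_word !gmulfM !multiplicativeZ uE vE.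
rewrite (eval_commg_a uE) (eval_commg_b uE) (eval_commg_b vE).
rewrite -[derived 0 0 0 1 0 0]/(lattice_point 0 0 1 0 0).
rewrite -[derived 0 0 0 0 1 0]/(lattice_point 0 0 0 1 0).
rewrite -[derived 0 0 0 0 0 1]/(lattice_point 0 0 0 0 1).
by rewrite !lattice_pointZ !lattice_pointM !model_simp.
Qed.

Lemma eval_gamma3 x : x \in gamma3 F ->
  exists i j k l m, eval x = lattice_point i j k l m.
Proof.
move=> /gamma3_expansion[i [j [k [l [m [z [z5 ->]]]]]]]; exists i, j, k, l, m.
by rewrite gmulfM (eval_gamma5 z5) mulg1 eval_basis.
Qed.

Lemma lattice_point0 : lattice_point 0 0 0 0 0 = 1. Proof. by []. Qed.

Lemma eval_gamma3_eq1 x : x \in gamma3 F -> eval x = 1 -> x \in gamma5.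
Proof.
move=> /gamma3_expansion[i [j [k [l [m [z [z5 ->]]]]]]].
rewrite gmulfM (eval_gamma5 z5) mulg1 eval_basis -lattice_point0.
by case/lattice_point_inj => -> -> -> -> ->; rewrite /basis_word /= !mul1g.
Qed.

Lemma eval_gamma3_surj i j k l m :
  exists2 x, x \in gamma3 F & eval x = lattice_point i j k l m.
Proof.
eexists; last exact: eval_basis.
have cx x : [~ c, x] \in gamma3 F.
  by apply: comm_subgroup_mem => //; apply: comm_subgroup_mem.
have cxy x y : [~ c, x, y] \in gamma3 F.
  by apply: (@comm_subgroup_subl F (gamma3 F) (full F)); apply: comm_subgroup_mem.
apply: gpredM; first exact/expz_mem/cx.
apply: gpredM; first exact/expz_mem/cx.
apply: gpredM; first exact/expz_mem/cxy.
by apply: gpredM; apply/expz_mem/cxy.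
Qed.

(** The exponents of a and b are all that a conjugating element contributes on derived elements;
    their integrality keeps lattices stable under conjugation. *)
Lemma eval_degrees x : exists (k l : int) g0 g1 g2 g3 g4 g5,
  eval x = (k%:~R, l%:~R, g0, g1, g2, g3, g4, g5)%R.
Proof.
pose S : {pred F} := fun x => `[< exists (k l : int) g0 g1 g2 g3 g4 g5,
  eval x = (k%:~R, l%:~R, g0, g1, g2, g3, g4, g5)%R >].
have Smul : mulg_closed S.
  move=> y z /asboolP[k [l [f0 [f1 [f2 [f3 [f4 [f5 yE]]]]]]]].
  move=> /asboolP[k' [l' [g0 [g1 [g2 [g3 [g4 [g5 zE]]]]]]]].
  apply/asboolP; exists (k + k')%R, (l + l')%R; do 6!eexists.
  by rewrite gmulfM yE zE !intrD.
have Sone : 1 \in S.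
  by apply/asboolP; exists 0%R, 0%R; do 6!eexists; rewrite multiplicative1.
have Sinv : invg_closed S.
  move=> y /asboolP[k [l [f0 [f1 [f2 [f3 [f4 [f5 yE]]]]]]]].
  apply/asboolP; exists (- k)%R, (- l)%R; do 6!eexists.
  by rewrite multiplicativeV yE !mulrNz.
pose m1 := isMulClosed.Build F S Smul; pose m2 := isMul1Closed.Build F S Sone.
pose m3 := isInvClosed.Build F S Sinv.
pose T : groupClosed F := HB.pack S m1 m2 m3.
suff /asboolP : x \in T by [].
apply: free_group2_ind; apply/asboolP.
  by exists 1%R, 0%R; do 6!eexists; rewrite eval_a.
by exists 0%R, 1%R; do 6!eexists; rewrite eval_b.
Qed.

Lemma eval_apower r (m m2 k : int) :
  eval r = (m%:~R, 0, k%:~R, 0, 0, 0, 0, 0)%R -> choose2 m%:~R = m2%:~R%R ->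
  [/\ eval [~ r, a, a] = lattice_point 0 0 k 0 0,
      eval [~ r, a, b] = lattice_point 0 0 0 k 0,
      eval [~ r, b, a] = lattice_point m 0 m2 k 0 &
      eval [~ r, b, b] = lattice_point 0 m 0 m2 k].
Proof.
move=> rE m2E; rewrite !(multiplicativeR eval) rE eval_a eval_b.
by rewrite commg_apower_a commg_apower_b !(commg_derived_a, commg_derived_b) m2E.
Qed.

Lemma eval_bpower r (n n2 k : int) :
  eval r = (0, n%:~R, k%:~R, 0, 0, 0, 0, 0)%R -> choose2 n%:~R = n2%:~R%R ->
  [/\ eval [~ r, a, a] = lattice_point (- n) 0 k (- n2) 0,
      eval [~ r, a, b] = lattice_point 0 (- n) 0 k (- n2),
      eval [~ r, b, a] = lattice_point 0 0 0 k 0 &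
      eval [~ r, b, b] = lattice_point 0 0 0 0 k].
Proof.
move=> rE n2E; rewrite !(multiplicativeR eval) rE eval_a eval_b.
rewrite commg_bpower_a commg_bpower_b !(commg_derived_a, commg_derived_b) n2E.
by rewrite /lattice_point !mulrNz.
Qed.

End Evaluation.

(** * Sublattices of Z^5 and the subgroup [R, F, F] *)

Section Lattice.
Local Open Scope ring_scope.

Definition vector_pred := int -> int -> int -> int -> int -> Prop.

Definition combination_closed (P : vector_pred) : Prop :=
  forall i j k l m i' j' k' l' m' r, P i j k l m -> P i' j' k' l' m' ->
    P (i + r * i') (j + r * j') (k + r * k') (l + r * l') (m + r * m').

(* The values on [a, b] x [a, b] of (x, y) |-> [~ r, x, y] when r is
   c ^ q, a ^ m * c ^ k1 or b ^ n * c ^ k2, in the coordinates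
   [~ c, a], [~ c, b], [~ c, a, a], [~ c, a, b], [~ c, b, b];
   here m2 and n2 are the binomial coefficients of m and n over 2. *)
Definition relator_vectors (q m m2 k1 n n2 k2 : int) (P : vector_pred) : Prop :=
  [/\ P 0 0 q 0 0, P 0 0 0 q 0 & P 0 0 0 0 q] /\
  [/\ P 0 0 k1 0 0, P 0 0 0 k1 0, P m 0 m2 k1 0 & P 0 m 0 m2 k1] /\
  [/\ P (- n) 0 k2 (- n2) 0, P 0 (- n) 0 k2 (- n2), P 0 0 0 k2 0 & P 0 0 0 0 k2].

(* With N = d * e * w this is the sublattice of Z^5 with quotient
   Z/(N e) x Z/N x (Z/d)^3: the first factor is read off i - k * e * w. *)
Definition in_lattice (d e w : int) : vector_pred := fun i j k l m =>
  exists s t j' l' m', [/\ i = d * e * w * (s + e * t), j = d * e * w * j',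
    k = d * s, l = d * l' & m = d * m'].

Lemma in_lattice_linear d e w : combination_closed (in_lattice d e w).
Proof.
move=> i j k l m i' j' k' l' m' r.
move=> [s [t [x [y [z [-> -> -> -> ->]]]]]] [s' [t' [x' [y' [z' [-> -> -> -> ->]]]]]].
exists (s + r * s'), (t + r * t'), (x + r * x'), (y + r * y'), (z + r * z').
by split; ring.
Qed.

End Lattice.

Arguments in_lattice (d e w i j k l m)%_R.
Arguments relator_vectors (q m m2 k1 n n2 k2)%_R.

Section Core.
Local Notation F := (free_group bool).
Local Notation a := fa.
Local Notation b := fb.
Local Notation c := [~ a, b].

Definition has_vector (P : vector_pred) (x : F) : Prop :=
  exists i j k l m, P i j k l m /\ eval x = lattice_point i j k l m.

Lemma has_vectorM (P : vector_pred) x y :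
  combination_closed P -> has_vector P x -> has_vector P y -> has_vector P (x * y).
Proof.
move=> Plin [i [j [k [l [m [Px xE]]]]]] [i' [j' [k' [l' [m' [Py yE]]]]]].
have := Plin _ _ _ _ _ _ _ _ _ _ 1%R Px Py; rewrite !mul1r => Pxy.
do 5!eexists; split; first exact: Pxy.
by rewrite gmulfM xE yE lattice_pointM.
Qed.

Lemma has_vectorV (P : vector_pred) x :
  combination_closed P -> P 0%R 0%R 0%R 0%R 0%R -> has_vector P x -> has_vector P x^-1.
Proof.
move=> Plin P0 [i [j [k [l [m [Px xE]]]]]].
have := Plin _ _ _ _ _ _ _ _ _ _ (- 1)%R P0 Px; rewrite !add0r => Px'.
do 5!eexists; split; first exact: Px'.
rewrite multiplicativeV xE; apply: mulg1_eq; rewrite lattice_pointM -lattice_point0.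
by congr lattice_point; ring.
Qed.

Lemma lattice_subgroup (d e w : int) : exists L : normalClosed F,
  forall x, x \in L <-> has_vector (in_lattice d e w) x.
Proof.
pose L : {pred F} := fun x => `[< has_vector (in_lattice d e w) x >].
have LP x : x \in L <-> has_vector (in_lattice d e w) x by split=> /asboolP.
have lat0 : in_lattice d e w 0 0 0 0 0.
  by exists 0%R, 0%R, 0%R, 0%R, 0%R; rewrite !(mulr0, addr0).
have Lmul : mulg_closed L.
  by move=> x y /LP xL /LP yL; apply/LP/has_vectorM => //; apply: in_lattice_linear.
have Lone : 1 \in L.
  apply/LP; exists 0%R, 0%R, 0%R, 0%R, 0%R; split; first exact: lat0.
  exact: (multiplicative1 eval).
have Linv : invg_closed L.
  by move=> x /LP xL; apply/LP/has_vectorV => //; apply: in_lattice_linear.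
have Lconj x y : x \in L -> x ^ y \in L.
  move=> xL; have -> : x ^ y = x * [~ x, y] by rewrite commgEl mulVKg.
  apply: Lmul => //; apply/LP.
  have [i [j [k [l [m [[s [t [j' [l' [m' [iE jE kE lE mE]]]]]] xE]]]]]] := (LP x).1 xL.
  have [u [v [g0 [g1 [g2 [g3 [g4 [g5 yE]]]]]]]] := eval_degrees y.
  exists 0%R, 0%R, (u * i)%R, (u * j + v * i)%R, (v * j)%R; split.
    (* The third coordinate [u * i] forces the first witness; it is a multiple of [e], so the second
       witness can bring the first coordinate back to 0. *)
    exists (u * e * w * (s + e * t))%R, (- (u * w * (s + e * t)))%R, 0%R.
    exists (u * e * w * j' + v * e * w * (s + e * t))%R, (v * e * w * j')%R.
    by rewrite iE jE; split; ring.
  rewrite (multiplicativeR eval) xE yE commg_derived !mulr0 !addr0.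
  by rewrite /lattice_point !(intrD, intrM).
pose m1 := isMulClosed.Build F L Lmul; pose m2 := isMul1Closed.Build F L Lone.
pose m3 := isInvClosed.Build F L Linv; pose m4 := isConjClosed.Build F L Lconj.
by pose N : normalClosed F := HB.pack L m1 m2 m3 m4; exists N.
Qed.

Variables (d e w q m m2 k1 n n2 k2 : int) (R : normalClosed F) (rA rB rC : F).
Hypothesis m2E : (choose2 m%:~R = m2%:~R)%R.
Hypothesis n2E : (choose2 n%:~R = n2%:~R)%R.
Hypothesis rAE : eval rA = (m%:~R, 0, k1%:~R, 0, 0, 0, 0, 0)%R.
Hypothesis rBE : eval rB = (0, n%:~R, k2%:~R, 0, 0, 0, 0, 0)%R.
Hypothesis rCE : eval rC = (0, 0, q%:~R, 0, 0, 0, 0, 0)%R.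

Definition contains_relators (S : {pred F}) : Prop :=
  [/\ rA \in S, rB \in S, rC \in S, [~ c, a] \in S & [~ c, b] \in S].

Hypothesis R_relators : contains_relators R.
Hypothesis R_min : forall S : normalClosed F, contains_relators S -> {subset R <= S}.
(** This hypothesis and the next say that the lattice is the span of the relator vectors. *)
Hypothesis relators_lattice : relator_vectors q m m2 k1 n n2 k2 (in_lattice d e w).
Hypothesis lattice_relators : forall P, combination_closed P ->
  relator_vectors q m m2 k1 n n2 k2 P ->
  forall i j k l m, in_lattice d e w i j k l m -> P i j k l m.

Local Notation RF := (comm_subgroup R (full F)).
Local Notation RFF := (comm_subgroup RF (full F)).
Local Notation gamma2 := (comm_subgroup (full F) (full F)).
Local Notation gamma4 := (comm_subgroup (gamma3 F) (full F)).
Local Notation gamma5 := (comm_subgroup gamma4 (full F)).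

Lemma gamma3_sub_R : {subset gamma3 F <= R}.
Proof.
have [_ _ _ ca cb] := R_relators.
apply/(comm_subgroup_subP R gamma2)/(comm_subgroup_subP (central_mod R) (full F)).
by move=> y _; apply: full_central_mod; apply: central_mod2.
Qed.

Lemma gamma5_sub_RFF : {subset gamma5 <= RFF}.
Proof.
by apply: comm_subgroup_sub => //; apply: comm_subgroup_sub => //; apply: gamma3_sub_R.
Qed.

(** The r with every [r, x, y] in [L] form a normal subgroup, so by [R_min] only the five relators
    are tested, each on four pairs of letters; for [c, a] and [c, b] the result already lies in
    gamma_5. *)
Lemma RFF_vector x : x \in RFF -> has_vector (in_lattice d e w) x.
Proof.
have [L LE] := lattice_subgroup d e w.
suff RL : {subset RFF <= L} by move=> /RL/LE.
apply/(comm_subgroup_subP L RF)/(comm_subgroup_subP (central_mod L) R).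
have in_L y i j k l m' : in_lattice d e w i j k l m' ->
    eval y = lattice_point i j k l m' -> y \in L.
  by move=> yL yE; apply/LE; exists i, j, k, l, m'.
have g5L : {subset gamma5 <= L}.
  move=> y y5; apply: (in_L _ 0 0 0 0 0)%R; last by rewrite eval_gamma5.
  by exists 0%R, 0%R, 0%R, 0%R, 0%R; rewrite !(mulr0, addr0).
have cg y z t : [~ c, y, z, t] \in L.
  by apply: g5L; do 3!(apply: comm_subgroup_mem => //); apply: comm_subgroup_mem.
have cL : forall r, [~ r, a, a] \in L -> [~ r, a, b] \in L ->
    [~ r, b, a] \in L -> [~ r, b, b] \in L -> r \in central_mod (central_mod L).
  by move=> r *; do 2!apply: central_mod2.
have [[q1 q2 q3] [[A1 A2 A3 A4] [B1 B2 B3 B4]]] := relators_lattice.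
have q0E : (choose2 0%:~R = 0%:~R)%R by [].
have [rA1 rA2 rA3 rA4] := eval_apower rAE m2E.
have [rB1 rB2 rB3 rB4] := eval_bpower rBE n2E.
(* A power of [c] is the case of exponent 0 of a. *)
have [rC1 rC2 rC3 rC4] := eval_apower (m := 0) rCE q0E.
apply: R_min; split; apply: cL.
- exact: in_L A1 rA1.
- exact: in_L A2 rA2.
- exact: in_L A3 rA3.
- exact: in_L A4 rA4.
- exact: in_L B1 rB1.
- exact: in_L B2 rB2.
- exact: in_L B3 rB3.
- exact: in_L B4 rB4.
- exact: in_L q1 rC1.
- exact: in_L q2 rC2.
- exact: in_L q2 rC3.
- exact: in_L q3 rC4.
- exact: cg.
- exact: cg.
- exact: cg.
- exact: cg.
- exact: cg.
- exact: cg.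
- exact: cg.
- exact: cg.
Qed.

(** The values attained on [RFF] are closed under combinations, hence fill the lattice; an element
    of gamma_3 with the same value as one of [RFF] differs from it by gamma_5. *)
Lemma vector_RFF x : x \in gamma3 F -> has_vector (in_lattice d e w) x -> x \in RFF.
Proof.
move=> x3 [i [j [k [l [m' [xL xE]]]]]].
pose P : vector_pred := fun i j k l m =>
  exists2 y, y \in RFF & eval y = lattice_point i j k l m.
have Plin : combination_closed P.
  move=> i1 j1 k1' l1 m1 i2 j2 k2' l2 m2' r [y yR yE] [z zR zE].
  exists (y * expz z r); first by rewrite gpredM ?expz_mem.
  rewrite gmulfM multiplicativeZ yE zE lattice_pointZ lattice_pointM.
  by congr lattice_point; ring.
have memP r u v i' j' k' l' m1 : r \in R ->
    eval [~ r, u, v] = lattice_point i' j' k' l' m1 ->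
    P i' j' k' l' m1.
  move=> rR rE; exists [~ r, u, v] => //.
  by apply: comm_subgroup_mem => //; apply: comm_subgroup_mem.
have [AR BR CR _ _] := R_relators.
have q0E : (choose2 0%:~R = 0%:~R)%R by [].
have [rA1 rA2 rA3 rA4] := eval_apower rAE m2E.
have [rB1 rB2 rB3 rB4] := eval_bpower rBE n2E.
have [rC1 rC2 rC3 rC4] := eval_apower (m := 0) rCE q0E.
have PR : relator_vectors q m m2 k1 n n2 k2 P.
  split; last split.
  - by split; [exact: memP CR rC1 | exact: memP CR rC2
      | exact: memP CR rC4].
  - by split; [exact: memP AR rA1 | exact: memP AR rA2
      | exact: memP AR rA3 | exact: memP AR rA4].
  - by split; [exact: memP BR rB1 | exact: memP BR rB2
      | exact: memP BR rB3 | exact: memP BR rB4].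
have [y yR yE] := lattice_relators Plin PR xL.
have y3 : y \in gamma3 F by have /andP[] := comm_RFF_sub yR.
have : y^-1 * x \in RFF.
  apply: gamma5_sub_RFF; apply: eval_gamma3_eq1; first by rewrite gpredM ?gpredVr.
  by rewrite gmulfM multiplicativeV yE xE mulVg.
by move=> yxR; rewrite -(mulVKg y x); apply: gpredM yR yxR.
Qed.

End Core.

(** * The lattice of relations *)

Section LatticeSpan.
Local Open Scope ring_scope.
Implicit Types (P : vector_pred) (d e w q m n : int).

Lemma vector_pred_eq P i j k l m i' j' k' l' m' :
  P i' j' k' l' m' -> i = i' -> j = j' -> k = k' -> l = l' -> m = m' -> P i j k l m.
Proof. by move=> ? -> -> -> -> ->. Qed.

Ltac combine Plin r H1 H2 :=
  apply: (vector_pred_eq (Plin _ _ _ _ _ _ _ _ _ _ r H1 H2)); ring.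

Lemma lattice_span P d e w : combination_closed P ->
  P (d * e * w) 0 d 0 0 -> P (d * e * w * e) 0 0 0 0 -> P 0 (d * e * w) 0 0 0 ->
  P 0 0 0 d 0 -> P 0 0 0 0 d ->
  forall i j k l m, in_lattice d e w i j k l m -> P i j k l m.
Proof.
move=> Plin g1 g2 g3 g4 g5 i j k l m [s [t [j' [l' [m' [-> -> -> -> ->]]]]]].
have P0 : P 0 0 0 0 0 by combine Plin (- 1 : int) g1 g1.
have h1 := Plin _ _ _ _ _ _ _ _ _ _ s P0 g1.
have h2 := Plin _ _ _ _ _ _ _ _ _ _ t h1 g2.
have h3 := Plin _ _ _ _ _ _ _ _ _ _ j' h2 g3.
have h4 := Plin _ _ _ _ _ _ _ _ _ _ l' h3 g4.
combine Plin m' h4 g5.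
Qed.

Definition presents_lattice q m m2 k1 n n2 k2 d e w : Prop :=
  relator_vectors q m m2 k1 n n2 k2 (in_lattice d e w) /\
  forall P, combination_closed P -> relator_vectors q m m2 k1 n n2 k2 P ->
    forall i j k l m, in_lattice d e w i j k l m -> P i j k l m.

(* The relations of K1 and K5: a ^ m = c ^ d and b ^ n = 1. *)
Lemma presents_lattice_K1_K5 d w Q Y M hm hn q m n :
  q = d * Q -> n = d * 1 * w -> n = q * Y -> m = n * M ->
  presents_lattice q m (m * hm) (- d) n (n * hn) 0 d 1 w.
Proof.
move=> qE nE nqE mE; split.
  rewrite mE nE qE; split; last split; split.
  - by exists Q, (- Q), 0, 0, 0; split; ring.
  - by exists 0, 0, 0, Q, 0; split; ring.
  - by exists 0, 0, 0, 0, Q; split; ring.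
  - by exists (- 1), 1, 0, 0, 0; split; ring.
  - by exists 0, 0, 0, (- 1), 0; split; ring.
  - by exists (w * M * hm), (M - w * M * hm), 0, (- 1), 0; split; ring.
  - by exists 0, 0, M, (w * M * hm), (- 1); split; ring.
  - by exists 0, (- 1), 0, (- (w * hn)), 0; split; ring.
  - by exists 0, 0, (- 1), 0, (- (w * hn)); split; ring.
  - by exists 0, 0, 0, 0, 0; split; ring.
  - by exists 0, 0, 0, 0, 0; split; ring.
move=> P Plin [[q1 q2 q3] [[A1 A2 A3 A4] [B1 B2 B3 B4]]].
have P0 : P 0 0 0 0 0 by combine Plin (- 1 : int) q1 q1.
have d1 : P 0 0 d 0 0 by combine Plin (- 1 : int) P0 A1.
have d2 : P 0 0 0 d 0 by combine Plin (- 1 : int) P0 A2.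
have N1 : P n 0 0 0 0.
  have h := Plin _ _ _ _ _ _ _ _ _ _ (- 1) P0 B1.
  apply: (vector_pred_eq (Plin _ _ _ _ _ _ _ _ _ _ (- (w * hn)) h d2));
    rewrite ?nE; ring.
have N2 : P 0 n 0 0 0.
  have h := Plin _ _ _ _ _ _ _ _ _ _ (- 1) P0 B2.
  apply: (vector_pred_eq (Plin _ _ _ _ _ _ _ _ _ _ (- (Y * hn)) h q3));
    rewrite ?nqE; ring.
have d3 : P 0 0 0 0 d.
  have h := Plin _ _ _ _ _ _ _ _ _ _ (- 1) P0 A4.
  have h' := Plin _ _ _ _ _ _ _ _ _ _ M h N2.
  apply: (vector_pred_eq (Plin _ _ _ _ _ _ _ _ _ _ (w * M * hm) h' d2));
    rewrite ?mE ?nE; ring.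
rewrite nE in N1 N2.
apply: lattice_span => //; first by combine Plin (1 : int) N1 d1.
by combine Plin (0 : int) N1 P0.
Qed.

(* The relations of K2: a ^ m = b ^ n = 1. *)
Lemma presents_lattice_K2 d w M hm hn m n :
  n = d * 1 * w -> m = n * M ->
  presents_lattice d m (m * hm) 0 n (n * hn) 0 d 1 w.
Proof.
move=> nE mE; split.
  rewrite mE nE; split; last split; split.
  - by exists 1, (- 1), 0, 0, 0; split; ring.
  - by exists 0, 0, 0, 1, 0; split; ring.
  - by exists 0, 0, 0, 0, 1; split; ring.
  - by exists 0, 0, 0, 0, 0; split; ring.
  - by exists 0, 0, 0, 0, 0; split; ring.
  - by exists (w * M * hm), (M - w * M * hm), 0, 0, 0; split; ring.
  - by exists 0, 0, M, (w * M * hm), 0; split; ring.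
  - by exists 0, (- 1), 0, (- (w * hn)), 0; split; ring.
  - by exists 0, 0, (- 1), 0, (- (w * hn)); split; ring.
  - by exists 0, 0, 0, 0, 0; split; ring.
  - by exists 0, 0, 0, 0, 0; split; ring.
move=> P Plin [[d1 d2 d3] [_ [B1 B2 _ _]]].
have P0 : P 0 0 0 0 0 by combine Plin (- 1 : int) d1 d1.
have N1 : P n 0 0 0 0.
  have h := Plin _ _ _ _ _ _ _ _ _ _ (- 1) P0 B1.
  apply: (vector_pred_eq (Plin _ _ _ _ _ _ _ _ _ _ (- (w * hn)) h d2));
    rewrite ?nE; ring.
have N2 : P 0 n 0 0 0.
  have h := Plin _ _ _ _ _ _ _ _ _ _ (- 1) P0 B2.
  apply: (vector_pred_eq (Plin _ _ _ _ _ _ _ _ _ _ (- (w * hn)) h d3));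
    rewrite ?nE; ring.
rewrite nE in N1 N2.
apply: lattice_span => //; first by combine Plin (1 : int) N1 d1.
by combine Plin (0 : int) N1 P0.
Qed.

(** * Families with b^n = c^d *)

Section RelationB.
Variables (d e w Q Y X hm hn kappa q m n : int).
Hypotheses (qE : q = d * e * Q) (nE : n = d * e * w).
Hypotheses (nqE : n = q * Y) (mE : m = n * e * X).

Lemma relator_vectors_B :
  relator_vectors q m (m * hm) (- (d * e * kappa)) n (n * hn) (- d) (in_lattice d e w).
Proof.
rewrite mE nE qE; split; last split; split.
(* That d e divides q is essential: it makes [s] a multiple of [e], which [t] compensates in the
   first coordinate. *)
- by exists (e * Q), (- Q), 0, 0, 0; split; ring.
- by exists 0, 0, 0, (e * Q), 0; split; ring.
- by exists 0, 0, 0, 0, (e * Q); split; ring.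
- by exists (- (e * kappa)), kappa, 0, 0, 0; split; ring.
- by exists 0, 0, 0, (- (e * kappa)), 0; split; ring.
- exists (e * (w * e * X * hm)), (X - w * e * X * hm), 0, (- (e * kappa)), 0.
  by split; ring.
- by exists 0, 0, (e * X), (e * w * e * X * hm), (- (e * kappa)); split; ring.
- by exists (- 1), 0, 0, (- (e * w * hn)), 0; split; ring.
- by exists 0, 0, (- 1), (- 1), (- (e * w * hn)); split; ring.
- by exists 0, 0, 0, (- 1), 0; split; ring.
- by exists 0, 0, 0, 0, (- 1); split; ring.
Qed.

(** The vector [N1] couples the first and third coordinates and makes the lattice non-diagonal. The
    relation for a is a^m = c^(d e kappa), with [kappa] 0 for [K3] and 1 for [K4]; only the vector
    with first coordinate n e is obtained differently in the two families, hence the hypothesis. *)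
Lemma presents_lattice_B :
  (forall P, combination_closed P -> P 0 0 q 0 0 -> P 0 0 (- (d * e * kappa)) 0 0 ->
     P n 0 d 0 0 -> P m 0 (m * hm) 0 0 -> P (n * e) 0 0 0 0) ->
  presents_lattice q m (m * hm) (- (d * e * kappa)) n (n * hn) (- d) d e w.
Proof.
move=> H; split; first exact: relator_vectors_B.
move=> P Plin [[q1 q2 q3] [[A1 A2 A3 A4] [B1 B2 B3 B4]]].
have P0 : P 0 0 0 0 0 by combine Plin (- 1 : int) q1 q1.
have d2 : P 0 0 0 d 0 by combine Plin (- 1 : int) P0 B3.
have d3 : P 0 0 0 0 d by combine Plin (- 1 : int) P0 B4.
have N1 : P n 0 d 0 0.
  have h := Plin _ _ _ _ _ _ _ _ _ _ (- 1) P0 B1.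
  apply: (vector_pred_eq (Plin _ _ _ _ _ _ _ _ _ _ (- (e * w * hn)) h d2));
    rewrite ?nE; ring.
have N2 : P 0 n 0 0 0.
  have h := Plin _ _ _ _ _ _ _ _ _ _ (- 1) P0 B2.
  have h' := Plin _ _ _ _ _ _ _ _ _ _ (- 1) h d2.
  apply: (vector_pred_eq (Plin _ _ _ _ _ _ _ _ _ _ (- (e * w * hn)) h' d3));
    rewrite ?nE; ring.
have M1 : P m 0 (m * hm) 0 0.
  combine Plin (e * kappa) A3 d2.
have E1 := H P Plin q1 A1 N1 M1.
by rewrite nE in N1 N2 E1; apply: lattice_span.
Qed.

End RelationB.

(* The relations of K3: a ^ m = 1 and b ^ n = c ^ d. *)
Lemma presents_lattice_K3 d e w Q Y hm hn q m n :
  q = d * e * Q -> n = d * e * w -> n = q * Y -> m = n * e ->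
  presents_lattice q m (m * hm) 0 n (n * hn) (- d) d e w.
Proof.
move=> qE nE nqE mE.
have -> : 0 = - (d * e * 0) by ring.
apply: (presents_lattice_B (Q := Q) (X := 1)) => //; first by rewrite mulr1.
move=> P Plin q1 _ _ M1.
(* Since m = n e, the vector [M1] has the right first coordinate, and [q] divides its third. *)
apply: (vector_pred_eq (Plin _ _ _ _ _ _ _ _ _ _ (- (Y * e * hm)) M1 q1));
  rewrite ?mE ?nqE; ring.
Qed.

(* The relations of K4: a ^ m = c ^ (d * e) and b ^ n = c ^ d. *)
Lemma presents_lattice_K4 d e w Q Y X hm hn q m n :
  q = d * e * Q -> n = d * e * w -> n = q * Y -> m = n * e * X ->
  presents_lattice q m (m * hm) (- (d * e)) n (n * hn) (- d) d e w.
Proof.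
move=> qE nE nqE mE.
have -> : d * e = d * e * 1 by ring.
apply: (presents_lattice_B (Q := Q) (X := X)) => //.
move=> P Plin _ A1 N1 _.
have P0 : P 0 0 0 0 0 by combine Plin (- 1 : int) A1 A1.
(* Multiplying the coupling vector by [e] gives third coordinate d e, which the relation for a
   cancels. *)
have h := Plin _ _ _ _ _ _ _ _ _ _ e P0 N1.
combine Plin (1 : int) h A1.
Qed.

End LatticeSpan.

(** * Coordinates on the quotient *)

Section CyclicCoordinates.

Definition cyc_gen (r : nat) : cyc r := inZp 1.

Lemma expg_cyc_gen r n : cyc_gen r ^+ n = inZp n :> 'I_r.-1.+1.
Proof.
elim: n => [|n IHn]; first exact: val_inj.
by rewrite expgSr IHn; apply: val_inj; rewrite /= modnDm addn1.
Qed.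

Lemma expz_cyc_gen_eq1 r (z : int) : (0 < r)%N ->
  expz (cyc_gen r) z = 1 <-> exists t, z = (r%:Z * t)%R.
Proof.
move=> r_gt0; have nat_case n : cyc_gen r ^+ n = 1 <-> (r %| n)%N.
  rewrite expg_cyc_gen /dvdn; split=> [/(congr1 val) /= nr|/eqP nr].
    by rewrite -[X in _ %% X](prednK r_gt0) nr.
  by apply: val_inj; rewrite /= prednK.
have dvd n : (r %| n)%N <-> exists t, (n%:Z = r%:Z * t)%R.
  split=> [/dvdnP[k ->]|[t nE]]; first by exists (Posz k); lia.
  by apply/dvdnP; exists `|t|%N; lia.
case: z => n /=; first by rewrite nat_case dvd.
split=> [/eqP | [t nE]].
  rewrite invg_eq1 => /eqP/nat_case/dvd[t nE]; exists (- t)%R.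
  by rewrite NegzE nE mulrN.
apply/eqP; rewrite invg_eq1; apply/eqP/nat_case/dvd; exists (- t)%R.
by rewrite mulrN -nE NegzE opprK.
Qed.

Lemma expz_cyc_gen_surj r (y : cyc r) : exists z, expz (cyc_gen r) z = y.
Proof.
exists (Posz (y : 'I_r.-1.+1)); rewrite /= expg_cyc_gen.
by apply: val_inj; rewrite /= modn_small.
Qed.

Definition cycn_point (r t : nat) (s : seq int) : cycn r t :=
  [ffun i : 'I_t => expz (cyc_gen r) (nth 0%R s i)].

Lemma cycn_point_eq1 r t s : (0 < r)%N -> size s = t ->
  cycn_point r t s = 1 <-> forall z, z \in s -> exists k, z = (r%:Z * k)%R.
Proof.
move=> r_gt0 st; split=> [/ffunP s1 z /(nthP 0%R)[i i_lt <-]|s1].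
  have := s1 (Ordinal (leq_trans i_lt (eq_leq st))).
  by rewrite !ffunE => /(expz_cyc_gen_eq1 _ r_gt0).
apply/ffunP => i; rewrite !ffunE; apply/expz_cyc_gen_eq1 => //.
by apply/s1/mem_nth; rewrite st.
Qed.

Lemma cycn_point_surj r t (y : cycn r t) : exists2 s, size s = t & cycn_point r t s = y.
Proof.
exists [seq projT1 (cid (expz_cyc_gen_surj (y i))) | i <- enum 'I_t].
  by rewrite size_map size_enum_ord.
apply/ffunP => i; rewrite ffunE (nth_map i) ?size_enum_ord // nth_ord_enum.
by case: cid.
Qed.

End CyclicCoordinates.

Section QuotientCoordinates.

(** An isomorphism of Z^5 modulo the lattice with [A], unpacked so that the quotient need not be
    formed. *)
Definition lattice_coordinates (A : groupType) (d e w : int)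
    (f : int -> int -> int -> int -> int -> A) : Prop :=
  [/\ forall i j k l m i' j' k' l' m',
        f (i + i')%R (j + j')%R (k + k')%R (l + l')%R (m + m')%R =
        f i j k l m * f i' j' k' l' m',
      forall i j k l m, f i j k l m = 1 <-> in_lattice d e w i j k l m &
      forall y, exists i j k l m, f i j k l m = y].

Lemma cycn_point2D r (i j i' j' : int) :
  cycn_point r 2 [:: (i + i')%R; (j + j')%R] =
  cycn_point r 2 [:: i; j] * cycn_point r 2 [:: i'; j'].
Proof. by apply/ffunP => -[[|[|]]] //= lt; rewrite !ffunE expzD. Qed.

Lemma cycn_point3D r (i j k i' j' k' : int) :
  cycn_point r 3 [:: (i + i')%R; (j + j')%R; (k + k')%R] =
  cycn_point r 3 [:: i; j; k] * cycn_point r 3 [:: i'; j'; k'].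
Proof. by apply/ffunP => -[[|[|[|]]]] //= lt; rewrite !ffunE expzD. Qed.

Lemma cycn_point2_eq1 r (i j : int) : (0 < r)%N ->
  cycn_point r 2 [:: i; j] = 1 <-> exists x y, i = (r%:Z * x)%R /\ j = (r%:Z * y)%R.
Proof.
move=> r_gt0; rewrite cycn_point_eq1 //; split=> [H|[x [y [-> ->]]] z].
  have [x xE] := H i (mem_head _ _); have [y yE] : exists y, j = (r%:Z * y)%R.
    by apply: H; rewrite !inE eqxx orbT.
  by exists x, y.
by rewrite !inE => /orP[]/eqP->; [exists x | exists y].
Qed.

Lemma cycn_point3_eq1 r (i j k : int) : (0 < r)%N ->
  cycn_point r 3 [:: i; j; k] = 1 <->
  exists x y z, [/\ i = (r%:Z * x)%R, j = (r%:Z * y)%R & k = (r%:Z * z)%R].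
Proof.
move=> r_gt0; rewrite cycn_point_eq1 //; split=> [H|[x [y [z [-> -> ->]]]] t].
  have [x xE] : exists x, i = (r%:Z * x)%R by apply: H; rewrite !inE eqxx.
  have [y yE] : exists y, j = (r%:Z * y)%R by apply: H; rewrite !inE eqxx orbT.
  have [z zE] : exists y, k = (r%:Z * y)%R by apply: H; rewrite !inE eqxx !orbT.
  by exists x, y, z.
by rewrite !inE => /or3P[]/eqP->; [exists x | exists y | exists z].
Qed.

Lemma cycn_point2_surj r (y : cycn r 2) : exists i j, cycn_point r 2 [:: i; j] = y.
Proof. by have [[|i [|j []]] //= _ <-] := cycn_point_surj y; exists i, j. Qed.

Lemma cycn_point3_surj r (y : cycn r 3) : exists i j k, cycn_point r 3 [:: i; j; k] = y.
Proof. by have [[|i [|j [|k []]]] //= _ <-] := cycn_point_surj y; exists i, j, k. Qed.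

Lemma pair_eq1 (A B : groupType) (x : A) (y : B) :
  ((x, y) : dsum A B) = 1 <-> x = 1 /\ y = 1.
Proof.
by split=> [xy|[-> ->]] //; split; [apply: (congr1 fst xy) | apply: (congr1 snd xy)].
Qed.

Lemma lattice_coordinates_1 (d w N : nat) : (0 < N)%N -> N = (d * w)%N ->
  exists f, @lattice_coordinates (dsum (cycn N 2) (cycn d 3)) d 1%R w f.
Proof.
move=> N_gt0 NE; have d_gt0 : (0 < d)%N by move: N_gt0; rewrite NE muln_gt0 => /andP[].
exists (fun i j k l m => (cycn_point N 2 [:: i; j], cycn_point d 3 [:: k; l; m])).
split=> [*|i j k l m|[y z]].
- by rewrite cycn_point2D cycn_point3D.
- rewrite pair_eq1 cycn_point2_eq1 // cycn_point3_eq1 //; split.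
    move=> [[x [y [-> ->]]] [s [l' [m' [-> -> ->]]]]].
    by exists s, (x - s)%R, y, l', m'; rewrite NE PoszM; split; ring.
  move=> [s [t [j' [l' [m' [-> -> -> -> ->]]]]]]; split; last by exists s, l', m'.
  by exists (s + t)%R, j'; rewrite NE PoszM; split; ring.
have [i [j <-]] := cycn_point2_surj y; have [k [l [m <-]]] := cycn_point3_surj z.
by exists i, j, k, l, m.
Qed.

Lemma lattice_coordinates_2 (d e w N E : nat) : (0 < N)%N -> (0 < e)%N ->
  N = (d * e * w)%N -> E = (N * e)%N ->
  exists f, @lattice_coordinates (dsum (dsum (cyc E) (cyc N)) (cycn d 3)) d e w f.
Proof.
move=> N_gt0 e_gt0 NE ->.
have d_gt0 : (0 < d)%N by move: N_gt0; rewrite NE !muln_gt0 => /andP[/andP[]].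
have E_gt0 : (0 < N * e)%N by rewrite muln_gt0 N_gt0.
exists (fun i j k l m =>
  ((expz (cyc_gen (N * e)) (i - k * (e%:Z * w%:Z))%R, expz (cyc_gen N) j),
   cycn_point d 3 [:: k; l; m])).
split=> [i j k l m i' j' k' l' m'|i j k l m|[[x y] z]].
- rewrite cycn_point3D expzD.
  have -> : (i + i' - (k + k') * (e%:Z * w%:Z) =
    (i - k * (e%:Z * w%:Z)) + (i' - k' * (e%:Z * w%:Z)))%R by ring.
  by rewrite expzD.
- rewrite !pair_eq1 !expz_cyc_gen_eq1 // cycn_point3_eq1 //; split.
    move=> [[[t iE] [j' ->]] [s [l' [m' [kE -> ->]]]]].
    exists s, t, j', l', m'; rewrite NE !PoszM; split=> //.
    by rewrite -(subrK (k * (e%:Z * w%:Z))%R i) iE kE NE !PoszM; ring.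
  move=> [s [t [j' [l' [m' [-> -> -> -> ->]]]]]]; rewrite NE !PoszM.
  by do 2?split; [exists t; ring | exists j' | exists s, l', m'].
have [i iE] := expz_cyc_gen_surj x; have [j jE] := expz_cyc_gen_surj y.
have [k [l [m <-]]] := cycn_point3_surj z.
by exists (i + k * (e%:Z * w%:Z))%R, j, k, l, m; rewrite addrK iE jE.
Qed.

End QuotientCoordinates.

(** * From presentations to multipliers *)

Section Presentations.
Local Notation F := (free_group bool).
Local Notation a := fa.
Local Notation b := fb.
Local Notation c := [~ a, b].

(** The factors [1^-1] keep the shape [r.1 / r.2] of [presented], and [c ^+ 0] stands for 1, so each
    family has exactly these relators up to order. *)
Definition relators (m k1 n k2 q : nat) : seq F :=
  [:: a ^+ m * (c ^+ k1)^-1; b ^+ n * (c ^+ k2)^-1; c ^+ q * 1^-1;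
      [~ c, a] * 1^-1; [~ c, b] * 1^-1].

(** The only use of oddness: [n./2] is (n - 1)/2, so the binomial coefficient is divisible by n. *)
Lemma choose2_odd n : odd n ->
  (choose2 n%:Z%:~R = (n%:Z * (n./2)%:Z)%:~R :> rat)%R.
Proof.
move=> n_odd; have nE : (n%:R = 1 + (n./2)%:R * 2 :> rat)%R.
  by rewrite -[in LHS](odd_double_half n) n_odd -muln2 natrD natrM.
by rewrite intrM -!pmulrn nE /choose2; field.
Qed.

Lemma eval_relator_a m k :
  eval (a ^+ m * (c ^+ k)^-1) = (m%:Z%:~R, 0, (- k%:Z)%:~R, 0, 0, 0, 0, 0)%R.
Proof.
rewrite gmulfM multiplicativeV !multiplicativeX eval_a eval_c expg_ma expg_derived0.
apply: (mulIg (derived k%:R 0 0 0 0 0)); rewrite mulgVK mulrNz -!pmulrn.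
by apply: model_eq; rewrite /choose2 /choose3; field.
Qed.

Lemma eval_relator_b n k :
  eval (b ^+ n * (c ^+ k)^-1) = (0, n%:Z%:~R, (- k%:Z)%:~R, 0, 0, 0, 0, 0)%R.
Proof.
rewrite gmulfM multiplicativeV !multiplicativeX eval_b eval_c expg_mb expg_derived0.
apply: (mulIg (derived k%:R 0 0 0 0 0)); rewrite mulgVK mulrNz -!pmulrn.
by apply: model_eq; rewrite /choose2 /choose3; field.
Qed.

Lemma eval_relator_c q : eval (c ^+ q * 1^-1) = (0, 0, q%:Z%:~R, 0, 0, 0, 0, 0)%R.
Proof. by rewrite divg1 multiplicativeX eval_c expg_derived0. Qed.

Lemma normal_closure_multiplier (A : groupType) (d e w : int) f
    (m k1 n k2 q : nat) (s : seq F) :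
  odd m -> odd n -> s =i relators m k1 n k2 q ->
  presents_lattice q m (m%:Z * (m./2)%:Z) (- k1%:Z)
    n (n%:Z * (n./2)%:Z) (- k2%:Z) d e w ->
  @lattice_coordinates A d e w f ->
  isomorphic (presentation_multiplier (normal_closure (mem s))) A.
Proof.
move=> m_odd n_odd sE [lat_in lat_gen] [fD fK fS].
pose R : normalClosed F := normal_closure (mem s).
pose rA := a ^+ m * (c ^+ k1)^-1; pose rB := b ^+ n * (c ^+ k2)^-1.
pose rC := c ^+ q * 1^-1.
have sR x : x \in relators m k1 n k2 q -> x \in R.
  by rewrite -sE => xs; apply/normal_closureP => S; apply.
have R_in : contains_relators rA rB rC R.
  by split; [| | | rewrite -[X in X \in _]divg1 | rewrite -[X in X \in _]divg1];
    apply: sR; rewrite !inE eqxx ?orbT.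
have R_min (S : normalClosed F) : contains_relators rA rB rC S -> {subset R <= S}.
  move=> [SA SB SC Sa Sb] x /normal_closureP; apply=> y ys.
  have : y \in relators m k1 n k2 q by rewrite -sE.
  rewrite /relators !inE.
  by case/or4P=> [/eqP->|/eqP->|/eqP->|/orP[]/eqP->] //; rewrite divg1.
have m2E := choose2_odd m_odd; have n2E := choose2_odd n_odd.
have rAE := eval_relator_a m k1; have rBE := eval_relator_b n k2.
have rCE := eval_relator_c q.
(* [numq] recovers the integer coordinates on gamma_3; elsewhere its value carries no meaning. *)
pose g x := let: (_, _, _, f1, f2, f3, f4, f5) := eval x in
  f (numq f1) (numq f2) (numq f3) (numq f4) (numq f5).
have gE x i j k l m' : eval x = lattice_point i j k l m' -> g x = f i j k l m'.
  by rewrite /g => ->; rewrite /lattice_point /derived !numq_int.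
apply: (multiplier_isomorphism (f := g)) => [x y|x|y].
- move=> /andP[_ /eval_gamma3[i [j [k [l [m' xE]]]]]].
  move=> /andP[_ /eval_gamma3[i' [j' [k' [l' [m'' yE]]]]]].
  rewrite (gE _ _ _ _ _ _ xE) (gE _ _ _ _ _ _ yE) -fD; apply: gE.
  by rewrite gmulfM xE yE lattice_pointM.
- move=> /andP[_ x3]; have [i [j [k [l [m' xE]]]]] := eval_gamma3 x3.
  rewrite (gE _ _ _ _ _ _ xE) fK; split=> [xL|].
    apply: (vector_RFF m2E n2E rAE rBE rCE R_in lat_gen x3).
    by exists i, j, k, l, m'.
  move=> /(RFF_vector m2E n2E rAE rBE rCE R_min lat_in)[i1 [j1 [k' [l1 [m1 [L1]]]]]].
  by rewrite xE => /lattice_point_inj[-> -> -> -> ->].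
have [i [j [k [l [m' <-]]]]] := fS y.
have [x x3 xE] := eval_gamma3_surj i j k l m'; exists x; last exact: gE.
by apply/andP; split=> //; apply: (gamma3_sub_R R_in).
Qed.

Lemma multiplier_of_presentation (G A : groupType) (s : seq F) :
  isomorphic G (quotient_group (normal_closure (mem s))) ->
  isomorphic (presentation_multiplier (normal_closure (mem s))) A ->
  has_2nilpotent_multiplier G A.
Proof.
move=> GK KA E R freeE GE; apply: isomorphic_trans KA.
apply: multiplier_independent => //.
  by exists bool, idfun; exists idfun.
exact: isomorphic_trans (isomorphic_sym GE) GK.
Qed.

End Presentations.

(** * The five families *)

Section FiveFamilies.
Variables (p : nat) (G : groupType).
Hypotheses (p_prime : prime p) (p_odd : odd p).

Local Notation F := (free_group bool).
Local Notation a := fa.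
Local Notation b := fb.
Local Notation c := [~ a, b].

Let p_gt0 i : (0 < p ^ i)%N. Proof. by rewrite expn_gt0 prime_gt0. Qed.
Let pX_odd i : odd (p ^ i). Proof. by rewrite oddX p_odd orbT. Qed.
Let pXD i j : (p ^ (i + j) = p ^ i * p ^ j)%N. Proof. exact: expnD. Qed.

(** Here d = p^rho, e = 1 and N = p^beta. [K5] is the case beta = alpha, so that bound is not
    strict. *)
Lemma multiplier_K1_K5 alpha beta gamma rho (s : seq F) :
  (beta <= alpha)%N -> (gamma <= beta)%N -> (rho <= gamma)%N ->
  s =i relators (p ^ alpha) (p ^ rho) (p ^ beta) 0 (p ^ gamma) ->
  isomorphic G (quotient_group (normal_closure (mem s))) ->
  has_2nilpotent_multiplier G (dsum (cycn (p ^ beta) 2) (cycn (p ^ rho) 3)).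
Proof.
move=> ba gb rg sE /multiplier_of_presentation; apply.
have NE : (p ^ beta = p ^ rho * p ^ (beta - rho))%N.
  by rewrite -pXD subnKC // (leq_trans rg).
have [f fC] := lattice_coordinates_1 (p_gt0 beta) NE.
apply: (normal_closure_multiplier _ _ sE _ fC) => //.
apply: (@presents_lattice_K1_K5 _ _ (p ^ (gamma - rho))%N (p ^ (beta - gamma))%N
  (p ^ (alpha - beta))%N); rewrite ?mulr1 -?PoszM -?pXD ?subnKC //.
exact: leq_trans gb.
Qed.

Lemma multiplier_K2 alpha beta gamma (s : seq F) :
  (beta <= alpha)%N -> (gamma <= beta)%N ->
  s =i relators (p ^ alpha) 0 (p ^ beta) 0 (p ^ gamma) ->
  isomorphic G (quotient_group (normal_closure (mem s))) ->
  has_2nilpotent_multiplier G (dsum (cycn (p ^ beta) 2) (cycn (p ^ gamma) 3)).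
Proof.
move=> ba gb sE /multiplier_of_presentation; apply.
have NE : (p ^ beta = p ^ gamma * p ^ (beta - gamma))%N by rewrite -pXD subnKC.
have [f fC] := lattice_coordinates_1 (p_gt0 beta) NE.
apply: (normal_closure_multiplier _ _ sE _ fC) => //.
by apply: (@presents_lattice_K2 _ _ (p ^ (alpha - beta))%N);
  rewrite ?mulr1 -?PoszM -?pXD ?subnKC.
Qed.

(** Here d = p^sigma and e = p^(alpha - beta), so N e = p^alpha; the bound by gamma makes d e divide
    q. *)
Lemma multiplier_K3 alpha beta gamma sigma (s : seq F) :
  (beta <= alpha)%N -> (gamma <= beta)%N -> (sigma + alpha - beta <= gamma)%N ->
  s =i relators (p ^ alpha) 0 (p ^ beta) (p ^ sigma) (p ^ gamma) ->
  isomorphic G (quotient_group (normal_closure (mem s))) ->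
  has_2nilpotent_multiplier G
    (dsum (dsum (cyc (p ^ alpha)) (cyc (p ^ beta))) (cycn (p ^ sigma) 3)).
Proof.
move=> ba gb sg sE /multiplier_of_presentation; apply.
have gammaE : gamma = (sigma + (alpha - beta) + (gamma - (sigma + alpha - beta)))%N by lia.
have betaE : beta = (sigma + (alpha - beta) + (beta - (sigma + alpha - beta)))%N by lia.
have NE : (p ^ beta = p ^ sigma * p ^ (alpha - beta) * p ^ (beta - (sigma + alpha - beta)))%N.
  by rewrite -!pXD -betaE.
have EE : (p ^ alpha = p ^ beta * p ^ (alpha - beta))%N by rewrite -pXD subnKC.
have [f fC] := lattice_coordinates_2 (p_gt0 beta) (p_gt0 (alpha - beta)) NE EE.
apply: (normal_closure_multiplier _ _ sE _ fC) => //.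
apply: (@presents_lattice_K3 _ _ _ (p ^ (gamma - (sigma + alpha - beta)))%N
  (p ^ (beta - gamma))%N); rewrite -!PoszM -!pXD.
- by rewrite -gammaE.
- by rewrite -betaE.
- by rewrite subnKC.
- by rewrite subnKC.
Qed.

(** Here d = p^sigma and e = p^(rho - sigma), so d e = p^rho; the bound rho <= sigma + alpha - beta
    makes n e divide m. *)
Lemma multiplier_K4 alpha beta gamma rho sigma (s : seq F) :
  (beta <= alpha)%N -> (gamma <= beta)%N ->
  (sigma <= rho)%N -> (rho <= gamma)%N -> (rho <= sigma + alpha - beta)%N ->
  s =i relators (p ^ alpha) (p ^ rho) (p ^ beta) (p ^ sigma) (p ^ gamma) ->
  isomorphic G (quotient_group (normal_closure (mem s))) ->
  has_2nilpotent_multiplier G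
    (dsum (dsum (cyc (p ^ (rho - sigma + beta))) (cyc (p ^ beta))) (cycn (p ^ sigma) 3)).
Proof.
move=> ba gb sr rg ra sE /multiplier_of_presentation; apply.
have gammaE : gamma = (sigma + (rho - sigma) + (gamma - rho))%N by lia.
have betaE : beta = (sigma + (rho - sigma) + (beta - rho))%N by lia.
have alphaE : alpha = (beta + (rho - sigma) + (alpha - (rho - sigma + beta)))%N by lia.
have rhoE : (p ^ rho = p ^ sigma * p ^ (rho - sigma))%N by rewrite -pXD subnKC.
have NE : (p ^ beta = p ^ sigma * p ^ (rho - sigma) * p ^ (beta - rho))%N.
  by rewrite -!pXD -betaE.
have EE : (p ^ (rho - sigma + beta) = p ^ beta * p ^ (rho - sigma))%N.
  by rewrite -pXD addnC.
have [f fC] := lattice_coordinates_2 (p_gt0 beta) (p_gt0 (rho - sigma)) NE EE.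
apply: (normal_closure_multiplier _ _ sE _ fC) => //.
rewrite rhoE PoszM.
apply: (@presents_lattice_K4 _ _ _ (p ^ (gamma - rho))%N (p ^ (beta - gamma))%N
  (p ^ (alpha - (rho - sigma + beta)))%N);
  rewrite -!PoszM -!pXD.
- by rewrite -gammaE.
- by rewrite -betaE.
- by rewrite subnKC.
- by rewrite -alphaE.
Qed.

End FiveFamilies.

Theorem theorem4p4 (p : nat) (gT : finGroupType)
    (p_prime : prime p) (p_odd : odd p)
    (p_group : p.-group [set: gT])
    (two_generated : exists x y : gT, <<[set x; y]>> = [set: gT])
    (class_two : nil_class [set: gT] = 2)
    (noncapable : ~ capable gT) :
  (forall alpha beta gamma rho : nat,
     (beta < alpha)%N -> (gamma <= beta)%N -> (1 <= gamma)%N -> (rho < gamma)%N ->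
     isomorphic gT (K1 p alpha beta gamma rho) ->
     has_2nilpotent_multiplier gT (dsum (cycn (p ^ beta) 2) (cycn (p ^ rho) 3)))
  /\
  (forall alpha beta gamma : nat,
     (beta < alpha)%N -> (gamma <= beta)%N -> (1 <= gamma)%N ->
     isomorphic gT (K2 p alpha beta gamma) ->
     has_2nilpotent_multiplier gT (dsum (cycn (p ^ beta) 2) (cycn (p ^ gamma) 3)))
  /\
  (forall alpha beta gamma sigma : nat,
     (beta < alpha)%N -> (gamma <= beta)%N -> (1 <= gamma)%N ->
     (sigma < sigma + alpha - beta < gamma)%N ->
     isomorphic gT (K3 p alpha beta gamma sigma) ->
     has_2nilpotent_multiplier gT
       (dsum (dsum (cyc (p ^ alpha)) (cyc (p ^ beta))) (cycn (p ^ sigma) 3)))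
  /\
  (forall alpha beta gamma rho sigma : nat,
     (beta < alpha)%N -> (gamma <= beta)%N -> (1 <= gamma)%N ->
     (sigma < rho < minn gamma (sigma + alpha - beta))%N ->
     isomorphic gT (K4 p alpha beta gamma rho sigma) ->
     has_2nilpotent_multiplier gT
       (dsum (dsum (cyc (p ^ (rho - sigma + beta))) (cyc (p ^ beta)))
             (cycn (p ^ sigma) 3)))
  /\
  (forall alpha gamma rho : nat,
     (gamma < alpha)%N -> (rho < gamma)%N ->
     isomorphic gT (K5 p alpha gamma rho) ->
     has_2nilpotent_multiplier gT (dsum (cycn (p ^ alpha) 2) (cycn (p ^ rho) 3))).
Proof.
pose c := [~ fa, fb]; pose ca := [~ c, fa] * 1^-1; pose cb := [~ c, fb] * 1^-1.
pose rA m k := fa ^+ m * (c ^+ k)^-1; pose rB n k := fb ^+ n * (c ^+ k)^-1.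
pose rC q := c ^+ q * 1^-1.
do 4?split.
- move=> alpha beta gamma rho /ltnW ba gb _ /ltnW rg.
  (* [s] lists the relators in the order of [K1], so its normal closure is convertible with the one
     in [presented]; it only remains to permute. *)
  apply: (multiplier_K1_K5 p_prime p_odd ba gb rg
    (s := [:: rC (p ^ gamma)%N; cb; ca; rB (p ^ beta)%N 0%N;
              rA (p ^ alpha)%N (p ^ rho)%N])).
  by move=> x; rewrite !inE; do 5!case: (x == _).
- move=> alpha beta gamma /ltnW ba gb _.
  apply: (multiplier_K2 p_prime p_odd ba gb
    (s := [:: rA (p ^ alpha)%N 0%N; rB (p ^ beta)%N 0%N; rC (p ^ gamma)%N; cb; ca])).
  by move=> x; rewrite !inE; do 5!case: (x == _).
- move=> alpha beta gamma sigma /ltnW ba gb _ /andP[_ /ltnW sg].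
  apply: (multiplier_K3 p_prime p_odd ba gb sg
    (s := [:: rA (p ^ alpha)%N 0%N; rC (p ^ gamma)%N; cb; ca;
              rB (p ^ beta)%N (p ^ sigma)%N])).
  by move=> x; rewrite !inE; do 5!case: (x == _).
- move=> alpha beta gamma rho sigma /ltnW ba gb _ /andP[/ltnW sr].
  rewrite leq_min => /andP[/ltnW rg /ltnW ra].
  apply: (multiplier_K4 p_prime p_odd ba gb sr rg ra
    (s := [:: rC (p ^ gamma)%N; cb; ca; rA (p ^ alpha)%N (p ^ rho)%N;
              rB (p ^ beta)%N (p ^ sigma)%N])).
  by move=> x; rewrite !inE; do 5!case: (x == _).
move=> alpha gamma rho /ltnW ga /ltnW rg.
apply: (multiplier_K1_K5 p_prime p_odd (leqnn alpha) ga rg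
  (s := [:: rC (p ^ gamma)%N; cb; ca; rB (p ^ alpha)%N 0%N;
            rA (p ^ alpha)%N (p ^ rho)%N])).
by move=> x; rewrite !inE; do 5!case: (x == _).
Qed.
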